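(* Let $U\in \mathrm{BV}(\Omega_T)$ be a weak solution of the initial boundary value problem for the Euler equations with boundary data $g$, let $U_h\in\mathcal V_h^0$ be a solution of the first or higher order finite volume scheme, and let $J$ be the functional with weights $\psi,\psi_\Gamma$ (all as defined in the context). Let $\tilde A:=\mathrm Df(U_h)$, i.e. $\tilde A=(\tilde A_1,\dots,\tilde A_d)$ with $\tilde A_k=\mathrm Df_k(U_h)$, and let $\tilde P_\pm:=P_\pm(\tilde A)$ be the corresponding projection matrices on $\Gamma_T$. Suppose $\varphi\in\mathcal V$ solves the approximate adjoint problem $$\partial_t\varphi+\tilde A^{\mathrm T}\nabla\varphi=\psi\quad\text{in }\Omega_T,\qquad \tilde P_+^{\mathrm T}(\varphi-\psi_\Gamma)=0\quad\text{on }\Gamma_T .$$ Define $$\varepsilon_J:=J(U)-J(U_h),$$ $$\varepsilon_\Gamma^-:=-\bigl((P_-(U^+)-P_-(U_h^+))\,g,\ \varphi\bigr)_{\Gamma_T},$$ $$\varepsilon_\Gamma^+:=-\bigl(P_+(U^+)\mathbf f_\nu(U^+)-P_+(U_h^+)\mathbf f_\nu(U_h^+),\ \varphi-\psi_\Gamma\bigr)_{\Gamma_T},$$ $$\varepsilon_\Omega:=\bigl(f(U)-f(U_h)-\tilde A(U-U_h),\ \nabla\varphi\bigr)_{\Omega_T},$$ and the time- and space-components $$\eta_k:=\sum_{i,m}\bigl(\mathcal F_\nu^m(U_h)-\mathbf f_\nu(U_h^+),\ (\mathrm{id}-\Pi^0_{I_m})\varphi\bigr)_{\partial V_i^m},$$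 $$\eta_h:=\sum_{i,m}\bigl(\mathcal F_\nu^m(U_h)-\mathbf f_\nu(U_h^+),\ (\mathrm{id}-\Pi^0_{V_i})\Pi^0_{I_m}\varphi\bigr)_{\partial V_i^m}.$$ Then $$\varepsilon_J+\varepsilon_\Gamma^-+\varepsilon_\Gamma^++\varepsilon_\Omega=\eta_k+\eta_h .$$
   Context: **Continuous problem.** $\Omega\subset\mathbb R^d$ is the spatial domain, $T>0$, $\Omega_T=\Omega\times[0,T)$, and $\Gamma_T=\partial\Omega_T$ is the full space-time boundary, with space-time outward unit normal $\nu$. The unknown is $U=(\varrho,\varrho v,\varrho E)^{\mathrm T}$ with values in $\mathbb R^{d+2}$. The flux $f=(f_1,\dots,f_d)$, with $f_k(U)\in\mathbb R^{d+2}$ the flux in the $k$-th coordinate direction, is the Euler flux $f(U)=(\varrho v,\ \varrho vv^{\mathrm T}+pI,\ v(\varrho E+p))^{\mathrm T}$ with $p=\varrho(E-\tfrac12 v^2)(\gamma-1)$, $\gamma=1.4$. For $\mathbb R^{d+2}$-valued $\varphi$ we write $f(U)\nabla\varphi=\sum_k f_k(U)\cdot\partial_{x_k}\varphi$ and, for a tuple of matrices $A=(A_1,\dots,A_d)$, $A^{\mathrm T}\nabla\varphi=\sum_k A_k^{\mathrm T}\partial_{x_k}\varphi$ and $(AW,\nabla\varphi)=\sum_k (A_kW,\partial_{x_k}\varphi)$. $(\cdot,\cdot)_S$ denotes the integral over $S$ of the Euclidean inner product. All traces and integrals that appear are understood to be well defined. The space-time flux is $\mathbf f(U)=(f(U),U)$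 and $\mathbf f_\nu(U)=\mathbf f(U)\cdot\nu$, where $\nu$ is the outward unit normal of $\Omega_T$ or of a space-time cell. A superscript $+$ denotes the interior trace on the boundary of $\Omega_T$ or of a space-time cell. **Projections onto eigenspaces.** For a real diagonalizable matrix $A=R\Lambda L$ with $L=R^{-1}$, $\Lambda=\mathrm{diag}(\lambda_i)$, set $P_\pm(A)=R\,\mathrm{diag}(\chi^\pm(\lambda_i))\,L$ with $\chi^\pm(\lambda)=\max(0,\mathrm{sign}(\pm\lambda))$. At a point of $\Gamma_T$ with normal $\nu$, $P_\pm(U):=P_\pm(\mathbf f_\nu'(U))$. For a tuple $\tilde A=(\tilde A_1,\dots,\tilde A_d)$, the corresponding projections $\tilde P_\pm$ on $\Gamma_T$ are $P_\pm$ of $\sum_k n_k\tilde A_k$ if $\nu=(n,0)$ and of $\pm I$ if $\nu=(0,\pm1)$. The matrices to which $P_\pm$ is applied are assumed diagonalizable. **Weak solution.** $\mathcal V=\{\varphi\in W^{1,\infty}(\Omega_T):\ \mathrm{supp}\,\varphi\subset\subset\overline{\Omega_T}\}$ (test functions may take nonzero boundary values). $U\in\mathrm{BV}(\Omega_T)$ is a weak solution of $U_t+\nabla\cdot f(U)=0$ in $\Omega_T$, $P_-(U^+)(\mathbf f_\nu(U^+)-g)=0$ on $\Gamma_T$, if for all $\varphi\in\mathcal V$ $$(U,\varphi_t)_{\Omega_T}+(f(U),\nabla\varphi)_{\Omega_T}-(P_+(U^+)\mathbf f_\nu(U^+),\varphi)_{\Gamma_T}=(P_-(U^+)g,\varphi)_{\Gamma_T}.$$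 **Grid.** $\overline\Omega$ is the union of the closures of open cells $V_i$; the closures of two different cells meet in the empty set or a union of common faces and vertices. $\Gamma_{ij}$ are the faces of $V_i$, with outer normal $n_{ij}$, and $\sum_j|\Gamma_{ij}|n_{ij}=0$ for every $i$. Let $0=t_0<\dots<t_N=T$, $I_m=[t_{m-1},t_m]$, $\Delta t_m=t_m-t_{m-1}$, $V_i^m=V_i\times I_m$, $\Gamma_{ij}^m=\Gamma_{ij}\times I_m$. $\mathcal V_h^0$ is the space of functions constant on each $V_i^m$, and $\mathcal V_h$ the space of functions that are Lipschitz continuous on each $V_i^m$. $U_h\in\mathcal V_h^0$ is identified with its values $U_i^m$; on $\partial V_i^m$ the interior trace is $U_h^+=U_i^m$. $U_i^0$ are the initial cell averages. Sums over $i,m$ run over all space-time cells. **Numerical fluxes.** On an interior face, $F_{ij}^m=F_{\mathrm{riem}}(U_i^m,U_j^m,n_{ij})$ is a conservative numerical flux (Riemann solver) consistent with the normal flux $f\cdot n_{ij}$ (for higher order schemes it may depend on a larger stencil of cell averages). On a boundary face $\Gamma_{ij}^m\subset\Gamma_T$, $F_{ij}^m=P_+(U_i^m)\mathbf f_{\nu_{ij}}(U_i^m)+P_-(U_i^m)\,g_{ij}^m$, where $g_{ij}^m$ is the average of $g$ over $\Gamma_{ij}^m$. For a fixed $\theta\in[0,1]$ the space-time numerical flux is $$\mathcal F_\nu^m(U_h)=\begin{cases}F_{ij}^m & \text{on interior and on boundary faces }\Gamma_{ij}^m,\ \nu=(n_{ij},0),\\ (1-\theta)U_i^{m-1}+\theta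 U_i^m & \text{on }V_i\times\{t_m\},\ \nu=(0,1),\ m\ge1,\\ U_i^0 & \text{on }V_i\times\{t_0\},\ \nu=(0,1),\ m=0.\end{cases}$$ On the bottom face $V_i\times\{t_{m-1}\}$ of $V_i^m$, with outward normal $(0,-1)$, the flux is minus the time flux of level $m-1$. Different values of $\theta$ correspond to different time discretizations, e.g. explicit Euler for $\theta=0$ and implicit Euler for $\theta=1$. **Scheme.** The first or higher order finite volume scheme (with implicit Euler time discretization) is $U_i^m+\frac{\Delta t_m}{|V_i|}\sum_j|\Gamma_{ij}|F_{ij}^m=U_i^{m-1}$, $m\ge1$; it is rewritten as the Galerkin method: find $U_h\in\mathcal V_h^0$ such that $N(U_h,\varphi_h)=0$ for all $\varphi_h\in\mathcal V_h^0$, where for $\varphi\in\mathcal V_h$ $$N(U_h,\varphi)=\sum_{i,m}(\mathcal F_\nu^m(U_h),\varphi)_{\partial V_i^m}-\sum_{i,m}\bigl((U_h,\varphi_t)_{V_i^m}+(f(U_h),\nabla\varphi)_{V_i^m}\bigr).$$ A solution $U_h$ of the scheme is understood to satisfy this Galerkin orthogonality. **Functional.** $J(U)=(U,\psi)_{\Omega_T}-(P_+(U^+)\mathbf f_\nu(U^+),\psi_\Gamma)_{\Gamma_T}$, with weights $\psi$ on $\Omega_T$ and $\psi_\Gamma$ on $\Gamma_T$. **$L^2$-projections.** On each cell $V_i^m$, $\Pi^0_{I_m}$ is the $L^2$-projection onto functions that are constant in time on $I_m$, i.e. $(\Pi^0_{I_m}\varphi)(x,t)=\frac1{\Delta t_m}\int_{I_m}\varphi(x,s)\,ds$,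 and $\Pi^0_{V_i}$ is the $L^2$-projection onto functions that are constant in space on $V_i$, i.e. $(\Pi^0_{V_i}\varphi)(x,t)=\frac1{|V_i|}\int_{V_i}\varphi(y,t)\,dy$. In the integrals over $\partial V_i^m$ the traces from inside $V_i^m$ of these cellwise functions are used.
   Formalization: The formula is false if g differs from its averages; it is shown when P_-(U_h^+)g equals P_- of its face averages and the initial data their cell averages, and for all g with the extra term (P_-(U_h^+)(g-g_h),φ) on Γ_T. Finite grid; U_h solves the implicit Euler scheme and N(U_h,·)=0. *)

(* Defs.v *)
From HB Require Import structures.
From mathcomp Require Import all_boot all_order all_algebra.
From mathcomp Require Import all_classical all_reals all_analysis.

Set Implicit Arguments.
Unset Strict Implicit.
Unset Printing Implicit Defensive.

Import Order.TTheory GRing.Theory Num.Theory.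
Import numFieldNormedType.Exports.

Local Open Scope classical_set_scope.
Local Open Scope ring_scope.

(* R^d is 'rV[R]_d with its Borel sigma-algebra, space-time is 'rV[R]_d * R. *)
HB.instance Definition _ (R : realType) (d : nat) :=
  @isMeasurable.Build (sigma_display (@open 'rV[R]_d)) 'rV[R]_d
    <<s @open 'rV[R]_d >> (@sigma_algebra0 _ setT (@open 'rV[R]_d))
    (@sigma_algebraC _ (@open 'rV[R]_d))
    (@sigma_algebra_bigcup _ setT (@open 'rV[R]_d)).

Notation spacetime R d := ('rV[R]_d * R)%type.

Section EuclideanSpace.
Context {R : realType} {d : nat}.
Implicit Types (x y : 'rV[R]_d) (A C : set 'rV[R]_d).

(* The values on boxes determine a Borel measure uniquely. *)
Definition is_lebesgue (vol : set 'rV[R]_d -> \bar R) : Prop :=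
  forall a b : 'rV[R]_d, (forall k, a 0 k <= b 0 k) ->
    vol [set x | forall k, a 0 k <= x 0 k <= b 0 k]
    = (\prod_(k < d) (b 0 k - a 0 k))%:E.

(* The norm of 'rV[R]_d is the maximum norm, hence the separate definition. *)
Definition inner x y : R := \sum_(k < d) x 0 k * y 0 k.

Definition enorm x : R := Num.sqrt (inner x x).

Definition diam C : \bar R :=
  ereal_sup [set (enorm (q.1 - q.2))%:E | q in C `*` C].

(* Volume of the Euclidean unit ball of R^s. *)
Fixpoint ball_volume (s : nat) : R :=
  match s with
  | 0%N => 1
  | 1%N => 2
  | s'.+2 => 2 * pi / s%:R * ball_volume s'
  end.

Definition hausdorff_weight (s : nat) C : \bar R :=
  if `[< C = set0 >] then 0%E
  else (ball_volume s * (fine (diam C) / 2) ^+ s)%:E.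

Definition hausdorff_pre (s : nat) (delta : R) A : \bar R :=
  ereal_inf [set (\sum_(0 <= j <oo) hausdorff_weight s (C j))%E |
    C in [set C : nat -> set 'rV[R]_d |
      A `<=` \bigcup_j C j /\ forall j, (diam (C j) <= delta%:E)%E]].

Definition hausdorff (s : nat) A : \bar R :=
  ereal_sup [set hausdorff_pre s delta A | delta in [set delta : R | 0 < delta]].

End EuclideanSpace.

(* Lipschitz along segments contained in D, with a common constant: the form
   in which the continuous representative of a function with essentially
   bounded weak derivatives is Lipschitz when D is not convex. *)
Definition segment_lipschitz {R : realType} {V W : normedModType R}
    (D : set V) (f : V -> W) : Prop :=
  exists L : R, forall x y : V,
    (forall s : R, 0 <= s <= 1 -> D (x + s *: (y - x))) ->
    `|f x - f y| <= L * `|x - y|.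

Definition dir_t {R : realType} {d : nat} : spacetime R d := (0, 1).
Definition dir_x {R : realType} {d : nat} (k : 'I_d) : spacetime R d :=
  (delta_mx 0 k, 0).

Definition d_t {R : realType} {d : nat} {W : normedModType R}
    (f : spacetime R d -> W) (p : spacetime R d) : W := 'D_dir_t f p.
Definition d_x {R : realType} {d : nat} {W : normedModType R} (k : 'I_d)
    (f : spacetime R d -> W) (p : spacetime R d) : W := 'D_(dir_x k) f p.

Definition C1c {R : realType} {d : nat} (D : set (spacetime R d))
    (z : spacetime R d -> R) : Prop :=
  [/\ forall p, differentiable z p,
      forall v, continuous (fun p => 'D_v z p)
    & exists K, [/\ compact K, K `<=` D & forall p, ~ K p -> z p = 0]].

Definition dot {R : realType} {n : nat} (a b : 'cV[R]_n) : R :=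
  \sum_(c < n) a c 0 * b c 0.

Definition vintegral {R : realType} {disp} {S : measurableType disp} {n : nat}
    (mu : {measure set S -> \bar R}) (A : set S) (h : S -> 'cV[R]_n)
    : 'cV[R]_n :=
  \col_c \int[mu]_(x in A) h x c 0.

Section FunctionSpaces.
Context {R : realType} {d : nat}.
Variable vol : {sigma_finite_measure set 'rV[R]_d -> \bar R}.
Local Notation ST := (spacetime R d).
Local Notation stvol := (vol \x @lebesgue_measure R)%E.

(* W^{1,oo}(D;R^n).  A member is given by its locally Lipschitz
   representative; by Rademacher's theorem the weak derivatives of that
   representative are its a.e. defined classical partial derivatives, so 'D is
   used to name them.  They are bounded because of segment_lipschitz. *)
Definition W1oo {n : nat} (D : set ST) (f : ST -> 'cV[R]_n) : Prop :=
  [/\ (exists M : R, forall p, D p -> `|f p| <= M),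
      segment_lipschitz D f,
      (forall c, measurable_fun D (fun p => f p c 0)),
      (forall v, v = dir_t \/ (exists k, v = dir_x k) ->
         {ae stvol, forall p, D p -> derivable f p v} /\
         (forall c, measurable_fun D (fun p => ('D_v f p) c 0)))
    & (forall v c z, v = dir_t \/ (exists k, v = dir_x k) -> C1c D z ->
         \int[stvol]_(p in D) (f p c 0 * 'D_v z p)
         = - \int[stvol]_(p in D) (('D_v f p) c 0 * z p))].

(* BV(D;R^n).  Testing component by component and bounding the components of
   the test field by 1 changes the total variation by a constant factor only. *)
Definition BV {n : nat} (D : set ST) (u : ST -> 'cV[R]_n) : Prop :=
  forall c,
    stvol.-integrable D (fun p => (u p c 0)%:E) /\
    exists C : R, forall (zt : ST -> R) (zx : 'I_d -> ST -> R),
      C1c D zt -> (forall k, C1c D (zx k)) ->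
      (forall p, `|zt p| <= 1) -> (forall k p, `|zx k p| <= 1) ->
      `| \int[stvol]_(p in D)
           (u p c 0 * (d_t zt p + \sum_(k < d) d_x k (zx k) p)) | <= C.

(* w is the value at the boundary point p of the trace from inside D of u: the
   mean deviation of u from w over D near p tends to 0. *)
Definition trace_at {n : nat} (D : set ST) (u : ST -> 'cV[R]_n) (p : ST)
    (w : 'cV[R]_n) : Prop :=
  (fun r : R => (fine (stvol (ball p r `&` D)))^-1 *
     \int[stvol]_(q in ball p r `&` D) `|u q - w|) @ 0^'+ --> (0 : R).

End FunctionSpaces.

Section Projections.
Context {R : realType} {n : nat}.

Definition chi_plus (l : R) : R := Num.max 0 (Num.sg l).
Definition chi_minus (l : R) : R := Num.max 0 (Num.sg (- l)).

(* The matrix does not depend on the diagonalisation that is picked. *)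
Definition spectral_fun (chi : R -> R) (A : 'M[R]_n) : 'M[R]_n :=
  xget 0 [set Q | exists (P : 'M[R]_n) (l : 'rV[R]_n),
    [/\ P \in unitmx, A = P *m diag_mx l *m invmx P
      & Q = P *m diag_mx (map_mx chi l) *m invmx P]].

Definition proj_plus (A : 'M[R]_n) : 'M[R]_n := spectral_fun chi_plus A.
Definition proj_minus (A : 'M[R]_n) : 'M[R]_n := spectral_fun chi_minus A.

Definition jacobian_mx (F : 'cV[R]_n -> 'cV[R]_n) (u : 'cV[R]_n) : 'M[R]_n :=
  \matrix_(i, j) ('D_(delta_mx j 0) F u) i 0.

End Projections.

Section Euler.
Context {R : realType} {d : nat}.

(* Blocks: density, momentum, total energy; 1 + (d + 1) = d + 2. *)
Definition state := 'cV[R]_(1 + (d + 1)).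

Definition rho (u : state) : R := usubmx u 0 0.
Definition mom (u : state) : 'cV[R]_d := usubmx (dsubmx u).
Definition rhoE (u : state) : R := dsubmx (dsubmx u) 0 0.

Definition gamma : R := 14%:R / 10%:R.
Definition vel (u : state) : 'cV[R]_d := (rho u)^-1 *: mom u.
Definition pressure (u : state) : R :=
  rho u * (rhoE u / rho u - 2^-1 * dot (vel u) (vel u)) * (gamma - 1).

Definition eflux (k : 'I_d) (u : state) : state :=
  col_mx ((rho u * vel u k 0)%:M)
    (col_mx (rho u *: (vel u k 0 *: vel u) + pressure u *: delta_mx k 0)
            ((vel u k 0 * (rhoE u + pressure u))%:M)).

(* The space-time flux in the direction nu = (n, tau). *)
Definition nflux (nu : spacetime R d) (u : state) : state :=
  \sum_(k < d) nu.1 0 k *: eflux k u + nu.2 *: u.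

Definition nflux' (nu : spacetime R d) (u : state) :=
  jacobian_mx (nflux nu) u.

Definition Pplus (nu : spacetime R d) (u : state) := proj_plus (nflux' nu u).
Definition Pminus (nu : spacetime R d) (u : state) := proj_minus (nflux' nu u).

(* A tilde_k = D f_k (u), and its combination along nu, which is
   sum_k n_k A tilde_k for nu = (n, 0) and +-I for nu = (0, +-1). *)
Definition Atilde (u : state) (k : 'I_d) := jacobian_mx (eflux k) u.
Definition Atilde_nu (nu : spacetime R d) (u : state) :=
  \sum_(k < d) nu.1 0 k *: Atilde u k + nu.2 *: 1%:M.
Definition Ptilde_plus (nu : spacetime R d) (u : state) :=
  proj_plus (Atilde_nu nu u).

End Euler.
Arguments state : clear implicits.

(* A face e is a face of the cell [lcell e] and, unless it lies on the boundary
   of the domain ([rcell e = None]), of the cell [rcell e]; [fnormal e] points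
   out of [lcell e]. *)
Record grid (R : realType) (d : nat) (I E : finType) := Grid {
  cell : I -> set 'rV[R]_d;
  face : E -> set 'rV[R]_d;
  lcell : E -> I;
  rcell : E -> option I;
  fnormal : E -> 'rV[R]_d;
  nsteps : nat;
  tm : nat -> R
}.

Inductive stface (E : Type) := Lat of E | Top | Bot.
Arguments Top {E}.
Arguments Bot {E}.

Section Grid.
Context {R : realType} {d : nat} {I E : finType}.
Variables (vol area : {sigma_finite_measure set 'rV[R]_d -> \bar R}).
Variable G : grid R d I E.
Local Notation ST := (spacetime R d).
Local Notation leb := (@lebesgue_measure R).

Definition is_face (i : I) (e : E) : bool :=
  (lcell G e == i) || (rcell G e == Some i).
Definition is_bface (e : E) : bool := rcell G e == None.

Definition onormal (i : I) (e : E) : 'rV[R]_d :=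
  if lcell G e == i then fnormal G e else - fnormal G e.

Definition cvol (i : I) : R := fine (vol (cell G i)).
Definition farea (e : E) : R := fine (area (face G e)).
Definition dtm (m : nat) : R := tm G m - tm G m.-1.
Definition Im (m : nat) : set R := `[tm G m.-1, tm G m].

(* area is the (d-1)-dimensional Hausdorff measure on the union of the faces. *)
Definition is_face_area : Prop :=
  forall A, measurable A ->
    area A = hausdorff d.-1 (A `&` \bigcup_(e in [set: E]) face G e).

(* The unit vectors n_ij are normal to the flat faces of V_i and point outward
   in the sense of Gauss and Green (De Giorgi): -n_ij times the surface
   measure is the distributional gradient of the indicator of V_i. *)
Definition gauss_green (i : I) : Prop :=
  forall (z : 'rV[R]_d -> R) (k : 'I_d),
    {within closure (cell G i), continuous z} ->
    (exists K, compact K /\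
       forall x, closure (cell G i) x -> ~ K x -> z x = 0) ->
    segment_lipschitz (cell G i) z ->
    {ae vol, forall x, cell G i x -> derivable z x (delta_mx 0 k)} ->
    measurable_fun (cell G i) (fun x => 'D_(delta_mx 0 k) z x) ->
    \int[vol]_(x in cell G i) ('D_(delta_mx 0 k) z x)
    = \sum_(e | is_face i e)
        onormal i e 0 k * \int[area]_(x in face G e) z x.

Definition is_space_grid (Omega : set 'rV[R]_d) : Prop :=
  [/\ [/\ forall i, open (cell G i),
          forall i, (0 < vol (cell G i) < +oo)%E,
          forall i, cell G i `<=` Omega,
          forall i j, i != j -> cell G i `&` cell G j = set0
        & closure Omega = \bigcup_(i in [set: I]) closure (cell G i)],
      [/\ forall i, closure (cell G i) `\` cell G i
                    = \bigcup_(e in [set e | is_face i e]) face G e,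
          forall e, closed (face G e),
          forall e, (area (face G e) < +oo)%E,
          forall e, vol (face G e) = 0%E
        & forall e e', e != e' -> area (face G e `&` face G e') = 0%E],
      [/\ (* up to lower-dimensional parts, closures meet in common faces *)
          forall i j, i != j ->
            area ((closure (cell G i) `&` closure (cell G j)) `\`
                  \bigcup_(e in [set e | is_face i e && is_face j e]) face G e)
            = 0%E,
          forall e, rcell G e != Some (lcell G e),
          forall e, is_bface e -> face G e `<=` closure Omega `\` Omega
        & area ((closure Omega `\` Omega) `\`
                \bigcup_(e in [set e | is_bface e]) face G e) = 0%E]
    & [/\ forall e, inner (fnormal G e) (fnormal G e) = 1,
          forall e x y, face G e x -> face G e y ->
            inner (fnormal G e) (x - y) = 0,
          forall i, gauss_green i
        & forall i, \sum_(e | is_face i e) farea e *: onormal i e = 0]].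

Definition is_time_grid (T : R) : Prop :=
  [/\ (0 < nsteps G)%N, tm G 0 = 0, tm G (nsteps G) = T
    & forall m, (m < nsteps G)%N -> tm G m < tm G m.+1].

Definition stcell (i : I) (m : nat) : set ST := cell G i `*` Im m.

Definition stnormal (i : I) (s : stface E) : ST :=
  match s with
  | Lat e => (onormal i e, 0)
  | Top => (0, 1)
  | Bot => (0, -1)
  end.

(* (q, w) over the boundary of V_i^m, for q constant on each face. *)
Definition bdpair (i : I) (m : nat) (q : stface E -> state R d)
    (w : ST -> state R d) : R :=
  \sum_(e | is_face i e)
    \int[(area \x leb)%E]_(p in face G e `*` Im m) dot (q (Lat e)) (w p)
  + \int[vol]_(x in cell G i) dot (q Top) (w (x, tm G m))
  + \int[vol]_(x in cell G i) dot (q Bot) (w (x, tm G m.-1)).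

(* The L^2-projections on V_i^m; the formulas also give the traces on the
   boundary of V_i^m from inside. *)
Definition Pi_time (m : nat) (w : ST -> state R d) (p : ST) : state R d :=
  (dtm m)^-1 *: vintegral leb (Im m) (fun s => w (p.1, s)).
Definition Pi_space (i : I) (w : ST -> state R d) (p : ST) : state R d :=
  (cvol i)^-1 *: vintegral vol (cell G i) (fun y => w (y, p.2)).

(* A function in V_h^0, given by its values W i m for 1 <= m <= nsteps.  On
   Gamma_T it is evaluated to its trace from inside Omega_T. *)
Definition cell_of (x : 'rV[R]_d) : option I :=
  [pick i | `[< cell G i x \/
    exists e, [/\ is_bface e, lcell G e = i & face G e x] >]].
Definition level_of (t : R) : nat :=
  (find (fun m => t <= tm G m.+1) (iota 0 (nsteps G))).+1.
Definition cellwise (W : I -> nat -> state R d) (p : ST) : state R d :=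
  if cell_of p.1 is Some i then W i (level_of p.2) else 0.

(* The outward normal of Omega on its boundary, read off the boundary faces,
   which cover it up to a null set. *)
Definition bnormal (x : 'rV[R]_d) : 'rV[R]_d :=
  if [pick e | is_bface e && `[< face G e x >]] is Some e
  then fnormal G e else 0.

End Grid.

Section Continuous.
Context {R : realType} {d : nat} {I E : finType}.
Variables (vol area : {sigma_finite_measure set 'rV[R]_d -> \bar R}).
Variable G : grid R d I E.
Variables (Omega : set 'rV[R]_d) (T : R).
Local Notation ST := (spacetime R d).
Local Notation leb := (@lebesgue_measure R).
Local Notation stvol := (vol \x leb)%E.

(* Without the null set Omega x {0}, so that Omega_T is open. *)
Definition OmegaT : set ST := Omega `*` `]0, T[.

(* Gamma_T consists of the lateral boundary and of Omega x {0}, Omega x {T}. *)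
Definition lateral : set ST := (closure Omega `\` Omega) `*` `]0, T[.

Definition GammaT_ae (P : ST -> Prop) : Prop :=
  [/\ {ae (area \x leb)%E, forall p, lateral p -> P p},
      {ae vol, forall x, Omega x -> P (x, 0)}
    & {ae vol, forall x, Omega x -> P (x, T)}].

Definition GammaT_integrable (h : ST -> R) : Prop :=
  [/\ (area \x leb)%E.-integrable lateral (fun p => (h p)%:E),
      vol.-integrable Omega (fun x => (h (x, 0))%:E)
    & vol.-integrable Omega (fun x => (h (x, T))%:E)].

Definition GammaT_vintegrable (h : ST -> state R d) : Prop :=
  forall c, GammaT_integrable (fun p => h p c 0).

Definition GammaT_pair (a b : ST -> state R d) : R :=
  \int[(area \x leb)%E]_(p in lateral) dot (a p) (b p)
  + \int[vol]_(x in Omega) dot (a (x, 0)) (b (x, 0))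
  + \int[vol]_(x in Omega) dot (a (x, T)) (b (x, T)).

Definition OmegaT_pair (a b : ST -> state R d) : R :=
  \int[stvol]_(p in OmegaT) dot (a p) (b p).

Definition nu (p : ST) : ST :=
  if p.2 == T then (0, 1) else if p.2 == 0 then (0, -1)
  else (bnormal G p.1, 0).

Definition outflow (u : ST -> state R d) (p : ST) : state R d :=
  Pplus (nu p) (u p) *m nflux (nu p) (u p).
Definition inflow (u b : ST -> state R d) (p : ST) : state R d :=
  Pminus (nu p) (u p) *m b p.

(* The space V; the values on the boundary are the traces. *)
Definition test_space (phi : ST -> state R d) : Prop :=
  [/\ W1oo vol OmegaT phi,
      {within closure OmegaT, continuous phi},
      (forall c, measurable_fun (closure OmegaT) (fun p => phi p c 0))
    & exists K, [/\ compact K, K `<=` closure OmegaT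
        & forall p, closure OmegaT p -> ~ K p -> phi p = 0]].

(* u is a weak solution with boundary data g and trace ut on Gamma_T. *)
Definition weak_solution (g u ut : ST -> state R d) : Prop :=
  [/\ BV vol OmegaT u,
      GammaT_ae (fun p => trace_at vol OmegaT u p (ut p)),
      [/\ (forall k c, stvol.-integrable OmegaT (fun p => (eflux k (u p) c 0)%:E)),
          GammaT_vintegrable (outflow ut),
          GammaT_vintegrable (inflow ut g)
        & GammaT_ae (fun p => diagonalizable (nflux' (nu p) (ut p)))]
    & forall phi, test_space phi ->
        OmegaT_pair u (d_t phi)
        + \int[stvol]_(p in OmegaT)
            (\sum_(k < d) dot (eflux k (u p)) (d_x k phi p))
        - GammaT_pair (outflow ut) phi
        = GammaT_pair (inflow ut g) phi].

(* J(u), where ut is the trace of u on Gamma_T. *)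
Definition J (psi psiG u ut : ST -> state R d) : R :=
  OmegaT_pair u psi - GammaT_pair (outflow ut) psiG.

(* The adjoint problem with coefficients A tilde = Df(uh). *)
Definition adjoint_solution (uh psi psiG phi : ST -> state R d) : Prop :=
  {ae stvol, forall p, OmegaT p ->
     d_t phi p + \sum_(k < d) (Atilde (uh p) k)^T *m d_x k phi p = psi p} /\
  GammaT_ae (fun p => diagonalizable (Atilde_nu (nu p) (uh p)) /\
     (Ptilde_plus (nu p) (uh p))^T *m (phi p - psiG p) = 0).

End Continuous.

Section Scheme.
Context {R : realType} {d : nat} {I E : finType}.
Variables (vol area : {sigma_finite_measure set 'rV[R]_d -> \bar R}).
Variable G : grid R d I E.
Local Notation ST := (spacetime R d).
Local Notation leb := (@lebesgue_measure R).

(* Fr U i e m is the flux out of V_i through the interior face e during I_m;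
   it may depend on all cell averages.  The first order case is
   Fr U i e m = F_riem (U i m) (U j m) n with j the neighbour across e. *)
Definition riemann_flux
    (Fr : (I -> nat -> state R d) -> I -> E -> nat -> state R d) : Prop :=
  (forall U e j m, rcell G e = Some j -> Fr U (lcell G e) e m = - Fr U j e m) /\
  (forall u i e m, is_face G i e -> ~~ is_bface G e ->
     Fr (fun _ _ => u) i e m = nflux (onormal G i e, 0) u).

Variable Fr : (I -> nat -> state R d) -> I -> E -> nat -> state R d.
Variables (theta : R) (g : ST -> state R d) (U : I -> nat -> state R d).

(* Averages of the data over boundary faces; on Omega x {0}, where nu = (0,-1),
   the boundary condition reads -u = g, so the initial value is -g. *)
Definition gavg (e : E) (m : nat) : state R d :=
  (farea area G e * dtm G m)^-1 *:
    vintegral (area \x leb)%E (face G e `*` Im G m) g.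
Definition initial_avg (i : I) : state R d :=
  (cvol vol G i)^-1 *: vintegral vol (cell G i) (fun x => - g (x, 0)).

Definition face_flux (i : I) (e : E) (m : nat) : state R d :=
  if is_bface G e then
    let n := (onormal G i e, 0) in
    Pplus n (U i m) *m nflux n (U i m) + Pminus n (U i m) *m gavg e m
  else Fr U i e m.

Definition time_flux (i : I) (m : nat) : state R d :=
  if m is m'.+1 then (1 - theta) *: U i m' + theta *: U i m else U i 0%N.

Definition stflux (i : I) (m : nat) (s : stface E) : state R d :=
  match s with
  | Lat e => face_flux i e m
  | Top => time_flux i m
  | Bot => - time_flux i m.-1
  end.

(* N(U_h, w), where w i m is the restriction to V_i^m of a function in V_h. *)
Definition galerkin_form (w : I -> nat -> ST -> state R d) : R :=
  \sum_(i : I) \sum_(1 <= m < (nsteps G).+1)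
    bdpair vol area G i m (stflux i m) (w i m)
  - \sum_(i : I) \sum_(1 <= m < (nsteps G).+1)
    (\int[(vol \x leb)%E]_(p in stcell G i m) dot (U i m) (d_t (w i m) p)
     + \int[(vol \x leb)%E]_(p in stcell G i m)
         (\sum_(k < d) dot (eflux k (U i m)) (d_x k (w i m) p))).

Definition fv_solution : Prop :=
  [/\ forall i, U i 0%N = initial_avg i,
      (forall i m, (1 <= m <= nsteps G)%N ->
         U i m + (dtm G m / cvol vol G i) *:
           (\sum_(e | is_face G i e) farea area G e *: face_flux i e m)
         = U i m.-1),
      (forall w : I -> nat -> state R d,
         galerkin_form (fun i m _ => w i m) = 0)
    & (forall e m, is_bface G e -> (1 <= m <= nsteps G)%N ->
         diagonalizable (nflux' (onormal G (lcell G e) e, 0) (U (lcell G e) m)))].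

(* The data imposed on Gamma_T coincide with the averages that enter the
   scheme. *)
Definition data_resolved : Prop :=
  (forall e m, is_bface G e -> (1 <= m <= nsteps G)%N ->
     let i := lcell G e in
     {ae (area \x leb)%E, forall p, (face G e `*` Im G m) p ->
        Pminus (onormal G i e, 0) (U i m) *m (g p - gavg e m) = 0}) /\
  (forall i, {ae vol, forall x, cell G i x -> - g (x, 0) = initial_avg i}).

(* (P_-(U_h^+) (g - g_h), phi) over Gamma_T, where g_h is the face-wise average
   of g; on Omega x {0} the projection is the identity, on Omega x {T} it is 0. *)
Definition data_oscillation (phi : ST -> state R d) : R :=
  \sum_(e | is_bface G e) \sum_(1 <= m < (nsteps G).+1)
    \int[(area \x leb)%E]_(p in face G e `*` Im G m)
      dot (Pminus (onormal G (lcell G e) e, 0) (U (lcell G e) m)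
             *m (g p - gavg e m)) (phi p)
  + \sum_(i : I) \int[vol]_(x in cell G i)
      dot (g (x, 0) + initial_avg i) (phi (x, 0)).

(* F_nu^m(U_h) - f_nu(U_h^+) on the boundary of V_i^m. *)
Definition flux_defect (i : I) (m : nat) (s : stface E) : state R d :=
  stflux i m s - nflux (stnormal G i s) (U i m).

Definition eta_k (phi : ST -> state R d) : R :=
  \sum_(i : I) \sum_(1 <= m < (nsteps G).+1)
    bdpair vol area G i m (flux_defect i m)
      (fun p => phi p - Pi_time G m phi p).

Definition eta_h (phi : ST -> state R d) : R :=
  \sum_(i : I) \sum_(1 <= m < (nsteps G).+1)
    bdpair vol area G i m (flux_defect i m)
      (fun p => Pi_time G m phi p - Pi_space vol G i (Pi_time G m phi) p).

End Scheme.

(* Main.v *)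
Require Import Defs.
From HB Require Import structures.
From mathcomp Require Import all_boot all_order all_algebra.
From mathcomp Require Import all_classical all_reals all_analysis.
From mathcomp Require Import measurable_realfun.
From mathcomp Require Import ring lra.

Set Implicit Arguments.
Unset Strict Implicit.
Unset Printing Implicit Defensive.

Import Order.TTheory GRing.Theory Num.Theory.
Import numFieldNormedType.Exports.

Local Open Scope classical_set_scope.
Local Open Scope ring_scope.

(** The left-hand side is the residual of U_h in disguise.  Insert the adjoint
    equation psi = phi_t + A^T grad phi into J(U) - J(U_h).  Since
    (A (U - U_h), grad phi) = (U - U_h, A^T grad phi), the terms with
    A = Df(U_h) are exactly those that eps_Omega removes, and what is left of
    the volume terms is (U, phi_t) + (f(U), grad phi) minus the same expression
    for U_h ([volume_terms]).  In the boundary terms psi_Gamma drops out in the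
    same way.  The contributions of U cancel by the weak formulation tested
    with phi, so that the left-hand side equals

      (P_+ f_nu(U_h) + P_- g, phi)_GammaT - (U_h, phi_t) - (f(U_h), grad phi).

    The sum eta_k + eta_h is N(U_h, phi).  On a cell U_h is a constant state, so
    the Gauss-Green formula turns the volume integrals of the cell into the
    boundary pairing of f_nu(U_h^+) with phi ([cell_gauss_green]); hence
    N(U_h, phi) is the sum of the pairings of the flux defects with phi.
    Subtracting the cell averages of phi changes nothing: by Galerkin
    orthogonality for the numerical fluxes, and because the normals of a closed
    cell sum to zero for f_nu(U_h^+).  The two projections only split phi minus
    its average into eta_k and eta_h ([eta_sum]).

    It remains to compare boundary fluxes.  In N(U_h, phi) the lateral fluxes
    through interior faces cancel in pairs, and the time fluxes telescope,
    since orthogonality and the scheme force the time flux at level m to be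
    U_i^m for every theta ([time_flux_eq], [flux_sum]).  On GammaT the normals
    (0, -1) and (0, 1) give the projections P_- = I and P_+ = I, so that the
    fluxes there are the initial data and U_h(T); on the lateral faces they are
    the upwind fluxes, with g replaced by its averages
    ([boundary_integral_discrete]).  The effect of this replacement is the
    data oscillation, which vanishes if the data equal their averages.

    Analytically, phi is only locally Lipschitz with almost everywhere defined
    derivatives.  Fubini reduces the Gauss-Green formula to vertical segments,
    where the fundamental theorem of calculus for Lipschitz functions applies
    ([lipschitz_FTC]), and to time slices, where the formula for the cell
    applies once the derivatives of the slice are known to be measurable
    ([measurable_derive]).  Pointwise values of U_h on GammaT and the matrices
    Df(U_h) are known only up to null sets, where cells or faces meet; therefore
    integrals are shown to be insensitive to null sets for arbitrary integrands
    ([ae_eq_Rintegral]). *)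

(** * Integrals and null sets *)

Section null_sets.
Local Open Scope ereal_scope.
Context dd (S : measurableType dd) (R : realType).
Variable mu : {measure set S -> \bar R}.
Implicit Types (f g : S -> \bar R) (D N : set S).
Import HBNNSimple.

(** The integral of a nonnegative function is the supremum of the integrals of
    the simple functions below it, and cutting these off on N does not change
    their integrals.  This works for arbitrary functions f and g. *)
Lemma ge0_null_le_integral f g N :
  (forall x, 0 <= f x) -> (forall x, 0 <= g x) ->
  measurable N -> mu N = 0 -> (forall x, ~ N x -> f x <= g x) ->
  \int[mu]_x f x <= \int[mu]_x g x.
Proof.
move=> f0 g0 mN N0 fg; rewrite !ge0_integralTE//.
apply: ge_ereal_sup => _ [h /= hf <-].
have mC : measurable (~` N) by exact: measurableC.
apply: le_ereal_sup_tmp; exists (sintegral mu (proj_nnsfun h mC)).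
  exists (proj_nnsfun h mC) => // x; rewrite -mrestrict patchE.
  case: ifPn => // /set_mem xN.
  exact: le_trans (hf x) (fg x xN).
rewrite -[leLHS]integralT_nnsfun [leLHS](@ge0_negligible_integral _ _ _ _ _ N)//.
- by rewrite setTD integral_nnsfun// mrestrict.
- by apply/measurable_EFinP.
- by move=> x _; rewrite lee_fin.
Qed.

Lemma null_eq_integral f g D N : measurable N -> mu N = 0 ->
  (forall x, D x -> ~ N x -> f x = g x) ->
  \int[mu]_(x in D) f x = \int[mu]_(x in D) g x.
Proof.
move=> mN N0 fg.
have h x : ~ N x -> (f \_ D) x = (g \_ D) x.
  by move=> Nx; rewrite !patchE; case: ifPn => // /set_mem Dx; exact: fg.
rewrite integral_mkcond [RHS]integral_mkcond integralE [RHS]integralE.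
congr (_ - _); apply/eqP; rewrite eq_le; apply/andP; split;
  by apply: (@ge0_null_le_integral _ _ N) => // x /h xfg;
    rewrite ?funeposE ?funenegE xfg.
Qed.

End null_sets.

Section null_sets_real.
Context dd (S : measurableType dd) (R : realType).
Variable mu : {measure set S -> \bar R}.
Implicit Types (f g : S -> R) (D N A B : set S).

Lemma ae_imp (P Q : S -> Prop) : (forall x, P x -> Q x) ->
  {ae mu, forall x, P x} -> {ae mu, forall x, Q x}.
Proof.
by move=> PQ [N [mN N0 sN]]; exists N; split => // x /= Qx; apply: sN => /PQ.
Qed.

Lemma ae_and (P Q : S -> Prop) : {ae mu, forall x, P x} ->
  {ae mu, forall x, Q x} -> {ae mu, forall x, P x /\ Q x}.
Proof.
move=> [N [mN N0 sN]] [M [mM M0 sM]]; exists (N `|` M); split.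
- exact: measurableU.
- by rewrite null_set_setU.
- by move=> x /not_andP[Px|Qx]; [left; exact: sN|right; exact: sM].
Qed.

Lemma bounded_on (f : S -> R) A (M : R) : (forall x, A x -> `|f x| <= M) ->
  [bounded f x | x in A].
Proof.
move=> fM; rewrite /bounded_near; near=> M0 => x Ax /=.
have /le_trans : `|f x| <= M by exact: fM.
apply; near: M0; apply: nbhs_pinfty_ge; exact: num_real.
Unshelve. all: by end_near.
Qed.

(** Stated for arbitrary functions, as it is applied to integrands built from
    Df(U_h) and from the point values of U_h on the boundary. *)
Lemma ae_eq_Rintegral f g D :
  {ae mu, forall x, D x -> f x = g x} ->
  \int[mu]_(x in D) f x = \int[mu]_(x in D) g x.
Proof.
move=> [N [mN N0 sN]]; congr fine.
apply: (null_eq_integral mN N0) => x Dx Nx; congr EFin.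
by apply: contrapT => fg; apply: Nx; apply: sN => /= /(_ Dx).
Qed.

Lemma negligible_sub_Rintegral f D E :
  E `<=` D -> mu.-negligible (D `\` E) ->
  \int[mu]_(x in D) f x = \int[mu]_(x in E) f x.
Proof.
move=> ED [N [mN N0 sN]]; rewrite Rintegral_mkcond [RHS]Rintegral_mkcond.
apply: ae_eq_Rintegral; exists N; split => //; apply: subset_trans sN => x /=.
move=> /not_implyP[_]; rewrite !patchE; case: ifPn => [/set_mem Dx|Dx].
  case: ifPn => [//|/negP]; rewrite inE => nE _; split => //.
by case: ifPn => // /set_mem /ED /mem_set; rewrite (negbTE Dx).
Qed.

Lemma Rintegral_eq0_ae f D : {ae mu, forall x, D x -> f x = 0} ->
  \int[mu]_(x in D) f x = 0.
Proof.
by move=> /ae_eq_Rintegral ->; rewrite /Rintegral integral0.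
Qed.

Lemma integrable_RZl (r : R) f D : measurable D ->
  mu.-integrable D (EFin \o f) -> mu.-integrable D (fun x => (r * f x)%:E).
Proof.
by move=> mD intf; exact: (integrableZl mD r intf).
Qed.

Lemma integrable_RD f g D : measurable D ->
  mu.-integrable D (EFin \o f) -> mu.-integrable D (EFin \o g) ->
  mu.-integrable D (fun x => (f x + g x)%:E).
Proof.
by move=> mD intf intg; exact: (integrableD mD intf intg).
Qed.

Lemma integrable_RB f g D : measurable D ->
  mu.-integrable D (EFin \o f) -> mu.-integrable D (EFin \o g) ->
  mu.-integrable D (fun x => (f x - g x)%:E).
Proof.
by move=> mD intf intg; exact: (integrableB mD intf intg).
Qed.

Lemma integrable_RMr f g D (M : R) : measurable D ->
  mu.-integrable D (EFin \o f) -> measurable_fun D g ->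
  (forall x, D x -> `|g x| <= M) ->
  mu.-integrable D (fun x => (f x * g x)%:E).
Proof.
move=> mD intf mg gM.
by exact: (integrableMl mD intf mg (bounded_on gM)).
Qed.

Lemma integrable_Rsum (J : Type) (s : seq J) (P : pred J) (h : J -> S -> R) D :
  measurable D -> (forall j, P j -> mu.-integrable D (EFin \o h j)) ->
  mu.-integrable D (fun x => (\sum_(j <- s | P j) h j x)%:E).
Proof.
move=> mD ih.
apply: (@eq_integrable _ _ _ _ _ mD
  (fun x => \sum_(j <- s | P j) (EFin \o h j) x)%E); last exact: integrable_sum.
by move=> x _; rewrite sumEFin.
Qed.

Lemma Rintegral_sum (J : Type) (s : seq J) (P : pred J) (h : J -> S -> R) D :
  measurable D -> (forall j, P j -> mu.-integrable D (EFin \o h j)) ->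
  \int[mu]_(x in D) (\sum_(j <- s | P j) h j x)
  = \sum_(j <- s | P j) \int[mu]_(x in D) h j x.
Proof.
move=> mD ih; elim: s => [|j s IH].
  rewrite big_nil; under eq_Rintegral do rewrite big_nil.
  by rewrite /Rintegral integral0.
rewrite big_cons; case: ifPn => Pj; last first.
  by rewrite -IH; apply: eq_Rintegral => x _; rewrite big_cons (negbTE Pj).
rewrite -IH -RintegralD//; [|exact: ih|exact: integrable_Rsum].
by apply: eq_Rintegral => x _; rewrite big_cons Pj.
Qed.

End null_sets_real.

(** * Fubini on product sets *)

Section fubini_sections.
Context d1 d2 (S1 : measurableType d1) (S2 : measurableType d2) (R : realType).
Variables (m1 : {sigma_finite_measure set S1 -> \bar R})
          (m2 : {sigma_finite_measure set S2 -> \bar R}).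
Local Notation m12 := (m1 \x m2)%E.

Lemma ge0_integral_eq0_ae dd (S : measurableType dd)
    (mu : {measure set S -> \bar R}) (h : S -> \bar R) :
  measurable_fun setT h -> (forall x, 0 <= h x)%E ->
  (\int[mu]_x h x = 0)%E -> {ae mu, forall x, h x = 0%E}.
Proof.
move=> mh h0 ih.
have /(ae_eq_integral_abs mu measurableT mh) : (\int[mu]_x `|h x| = 0)%E.
  by rewrite -[RHS]ih; apply: eq_integral => x _; rewrite gee0_abs.
by apply: filterS => x; exact.
Qed.

Lemma ae_xsection (P : S1 * S2 -> Prop) : {ae m12, forall p, P p} ->
  {ae m1, forall x, {ae m2, forall y, P (x, y)}}.
Proof.
move=> [N [mN N0 sN]].
have : {ae m1, forall x, m2 (xsection N x) = 0%E}.
  apply: ge0_integral_eq0_ae; last exact: N0.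
  - exact: measurable_fun_xsection.
  - by [].
apply: filterS => x Nx0; exists (xsection N x); split => //.
  exact: measurable_xsection.
by move=> y /= Pxy; rewrite /xsection /ysection /=; apply/mem_set; exact: sN.
Qed.

(** Turns derivatives that exist almost everywhere in space-time into
    derivatives that exist almost everywhere on almost every time slice. *)
Lemma ae_ysection (P : S1 * S2 -> Prop) : {ae m12, forall p, P p} ->
  {ae m2, forall y, {ae m1, forall x, P (x, y)}}.
Proof.
move=> [N [mN N0 sN]].
have : {ae m2, forall y, m1 (ysection N y) = 0%E}.
  apply: ge0_integral_eq0_ae.
  - exact: measurable_fun_ysection.
  - by [].
  have -> : (\int[m2]_y m1 (ysection N y) = (m1 \x^ m2) N)%E by [].
  rewrite -N0; apply/esym/(product_measure_unique (m' := (m1 \x^ m2)%E)) => //.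
  by move=> A B mA mB; rewrite -product_measure2E.
apply: filterS => y Ny0; exists (ysection N y); split => //.
  exact: measurable_ysection.
by move=> x /= Pxy; rewrite /xsection /ysection /=; apply/mem_set; exact: sN.
Qed.

Variables (A : set S1) (B : set S2) (f : S1 * S2 -> R).
Hypotheses (mA : measurable A) (mB : measurable B).
Hypothesis intf : m12.-integrable (A `*` B) (EFin \o f).

Let mAB : measurable (A `*` B). Proof. exact: measurableX. Qed.

(** The extension of f by zero, to which Fubini on the whole product applies. *)
Let h p := ((f \_ (A `*` B)) p)%:E.

Let inth : m12.-integrable setT h.
Proof.
by have := (integrable_mkcond _ mAB).1 intf; rewrite restrict_EFin.
Qed.

Let hE1 x : A x -> fubini_F m2 h x = (\int[m2]_(y in B) (f (x, y))%:E)%E.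
Proof.
move=> Ax; rewrite [RHS]integral_mkcond; apply: eq_integral => y _.
rewrite /h !patchE; case: ifPn => [/set_mem [_ By]|xy]; first by rewrite mem_set.
by rewrite memNset// => By; move/negP: xy; apply; exact/mem_set.
Qed.

Let hE1' x : ~ A x -> fubini_F m2 h x = 0%E.
Proof.
move=> Ax; apply: integral0_eq => y _.
by rewrite /h patchE memNset// => -[].
Qed.

Let hE2 y : B y -> fubini_G m1 h y = (\int[m1]_(x in A) (f (x, y))%:E)%E.
Proof.
move=> By; rewrite [RHS]integral_mkcond; apply: eq_integral => x _.
rewrite /h !patchE; case: ifPn => [/set_mem [Ax _]|xy]; first by rewrite mem_set.
by rewrite memNset// => Ax; move/negP: xy; apply; exact/mem_set.
Qed.

Let hE2' y : ~ B y -> fubini_G m1 h y = 0%E.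
Proof.
move=> By; apply: integral0_eq => x _.
by rewrite /h patchE memNset// => -[].
Qed.

Let intG : m2.-integrable setT (fubini_G m1 h).
Proof.
have mh : measurable_fun setT h by exact: measurable_int inth.
apply/integrableP; split; first exact: measurable_fubini_G inth.
apply: le_lt_trans ((integrable21ltyP m1 m2 mh).1 inth).
have mG : measurable_fun setT (fun y => \int[m1]_x `|h (x, y)|)%E.
  apply: (measurable_fun_fubini_tonelli_G (abse \o h)) => //=.
  exact: measurableT_comp.
apply: ge0_le_integral => //.
- by apply: measurableT_comp => //; exact: measurable_fubini_G inth.
- move=> y _; apply: le_abse_integral => //.
  exact: measurableT_comp.
Qed.

(** The inner integrals of f may fail to be finite on a null set, where their
    real values are meaningless; so the real-valued identity is obtained from
    the extended one up to that null set. *)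
Lemma Rintegral_prodl :
  \int[m12]_(p in A `*` B) f p = \int[m1]_(x in A) \int[m2]_(y in B) f (x, y).
Proof.
rewrite {1}/Rintegral integral_mkcond restrict_EFin -/h.
rewrite -(integral12_prod_meas1 inth); congr fine.
have intF := integrable_fubini_F inth.
have [N [mN N0 sN]] := integrable_ae measurableT intF.
rewrite [RHS]integral_mkcond.
apply: (null_eq_integral mN N0) => x _ Nx.
have fx : fubini_F m2 h x \is a fin_num.
  by apply: contrapT => fx; apply: Nx; apply: sN => /= /(_ I).
rewrite patchE; case: ifPn => [/set_mem Ax|/negP xA].
  by rewrite /Rintegral -hE1// fineK.
by rewrite hE1'// => Ax; apply: xA; exact/mem_set.
Qed.

Lemma Rintegral_prodr :
  \int[m12]_(p in A `*` B) f p = \int[m2]_(y in B) \int[m1]_(x in A) f (x, y).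
Proof.
rewrite {1}/Rintegral integral_mkcond restrict_EFin -/h.
rewrite -(integral21_prod_meas1 inth); congr fine.
have [N [mN N0 sN]] := integrable_ae measurableT intG.
rewrite [RHS]integral_mkcond.
apply: (null_eq_integral mN N0) => y _ Ny.
have fy : fubini_G m1 h y \is a fin_num.
  by apply: contrapT => fy; apply: Ny; apply: sN => /= /(_ I).
rewrite patchE; case: ifPn => [/set_mem By|/negP yB].
  by rewrite /Rintegral -hE2// fineK.
by rewrite hE2'// => By; apply: yB; exact/mem_set.
Qed.

Lemma integrable_prodl :
  m1.-integrable A (fun x => (\int[m2]_(y in B) f (x, y))%:E).
Proof.
have intF := integrable_fubini_F inth.
have {}intF : m1.-integrable A (fubini_F m2 h).
  exact: integrableS intF.
apply: (le_integrable mA _ _ intF).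
  apply: (eq_measurable_fun (fun x => (fine (fubini_F m2 h x))%:E)).
    by move=> x /set_mem Ax; rewrite hE1.
  apply/measurable_EFinP; apply: measurableT_comp => //.
  exact: measurable_int intF.
move=> x Ax; rewrite hE1// /Rintegral.
by case: (\int[m2]_(y in B) (f (x, y))%:E)%E => [r| |] //=; rewrite normr0 leey.
Qed.

Lemma integrable_prodr :
  m2.-integrable B (fun y => (\int[m1]_(x in A) f (x, y))%:E).
Proof.
have intF : m2.-integrable B (fubini_G m1 h).
  exact: integrableS intG.
apply: (le_integrable mB _ _ intF).
  apply: (eq_measurable_fun (fun x => (fine (fubini_G m1 h x))%:E)).
    by move=> x /set_mem Ax; rewrite hE2.
  apply/measurable_EFinP; apply: measurableT_comp => //.
  exact: measurable_int intF.
move=> x Ax; rewrite hE2// /Rintegral.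
by case: (\int[m1]_(y in A) (f (y, x))%:E)%E => [r| |] //=; rewrite normr0 leey.
Qed.

End fubini_sections.

(** * The fundamental theorem of calculus for Lipschitz functions *)

Section difference_quotients.
Context {R : realType} {V W : normedModType R}.

Lemma harmonic_dnbhs : @harmonic R @ \oo --> (0 : R)^'.
Proof.
move=> A nA.
have : \forall n \near \oo, (@harmonic R n != 0 -> A (harmonic n)).
  exact: (@cvg_harmonic R _ nA).
by apply: filterS => n; apply; rewrite gt_eqF// harmonic_gt0.
Qed.

(** A sequence of steps, rather than a filter, is what dominated convergence
    and the measurability of limits ask for. *)
Lemma derivable_cvg_quotient (f : V -> W) (x v : V) : derivable f x v ->
  (fun n => (harmonic n)^-1 *: (f (harmonic n *: v + x) - f x)) @ \oo
    --> 'D_v f x.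
Proof. by move=> df; apply: (cvg_comp _ _ harmonic_dnbhs df). Qed.

End difference_quotients.

Section lipschitz_FTC.
Context {R : realType}.
Local Notation leb := (@lebesgue_measure R).
Implicit Types (f g F : R -> R) (a b L : R).

(** Composition with the clamp extends a function from [a, b] to the line by
    constants, so that its shifted difference quotients are defined up to b. *)
Let clamp a b (t : R) : R := Num.max a (Num.min b t).

Let clamp_id a b t : t \in `[a, b] -> clamp a b t = t.
Proof.
rewrite in_itv/= => /andP[at_ tb]; rewrite /clamp (min_r tb); exact: max_r.
Qed.

Let clamp_in a b t : a <= b -> clamp a b t \in `[a, b].
Proof.
move=> ab; rewrite in_itv/= /clamp le_max lexx/= ge_max ab/= ge_min lexx//.
Qed.

Let clamp_cont a b : continuous (clamp a b).
Proof.
move=> t; apply: continuous_max; first exact: cvg_cst.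
by apply: continuous_min; [exact: cvg_cst|exact: cvg_id].
Qed.

Let clamp_lip a b s t : `|clamp a b s - clamp a b t| <= `|s - t|.
Proof.
rewrite /clamp /Num.max /Num.min.
have h1 : s - t <= `|s - t| by exact: ler_norm.
have h2 : t - s <= `|s - t| by rewrite distrC; exact: ler_norm.
by case: (ltP b s) => ?; case: (ltP b t) => ?; case: (ltP a b) => ?;
   case: (ltP a s) => ?; case: (ltP a t) => ?; rewrite ler_norml; lra.
Qed.

(** Each side of the inequality is continuous in x and in y, so the inequality
    passes to the closure in one variable after the other. *)
Lemma lipschitz_closed_itv F a b L : continuous F -> a < b ->
  (forall x y, x \in `]a, b[ -> y \in `]a, b[ ->
     `|F x - F y| <= L * `|x - y|) ->
  forall x y, x \in `[a, b] -> y \in `[a, b] -> `|F x - F y| <= L * `|x - y|.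
Proof.
move=> cF ab FL.
have cl y : closed [set x | `|F x - F y| <= L * `|x - y|].
  have -> : [set x | `|F x - F y| <= L * `|x - y|] =
            (fun x => L * `|x - y| - `|F x - F y|) @^-1` [set z | 0 <= z].
    by apply/seteqP; split => x /=; rewrite subr_ge0.
  apply: closed_comp; last exact: closed_ge.
  move=> x _; apply: cvgB; last first.
    by apply: cvg_norm; apply: cvgB; [exact: cF|exact: cvg_cst].
  apply: cvgM; first exact: cvg_cst.
  by apply: cvg_norm; apply: cvgB; [exact: cvg_id|exact: cvg_cst].
have ext (A : set R) : closed A -> (forall x, x \in `]a, b[ -> A x) ->
    forall x, x \in `[a, b] -> A x.
  move=> clA Aab x; rewrite in_itv/= => /andP[].
  rewrite le_eqVlt => /predU1P[<-|ax] xb.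
    have nA : \forall z \near a^'+, A z.
      near=> z; apply: Aab; rewrite in_itv/=; apply/andP; split; near: z.
        exact: nbhs_right_gt.
      exact: nbhs_right_lt.
    apply: (closed_cvg A clA nA); apply: cvg_at_right_filter; exact: cvg_id.
  move: xb; rewrite le_eqVlt => /predU1P[->|xb]; last first.
    by apply: Aab; rewrite in_itv/= ax.
  have nA : \forall z \near b^'-, A z.
    near=> z; apply: Aab; rewrite in_itv/=; apply/andP; split; near: z.
      exact: nbhs_left_gt.
    exact: nbhs_left_lt.
  apply: (closed_cvg A clA nA); apply: cvg_at_left_filter; exact: cvg_id.
move=> x y xab yab; apply: (ext _ (cl y)) xab => z zab.
rewrite /= distrC [`|z - y|]distrC.
exact: (ext _ (cl z) (fun w wab => FL w z wab zab) y yab).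
Unshelve. all: by end_near.
Qed.

(** If G is a primitive of f, the difference quotient of G is a primitive of
    the difference quotient of f.  The integral over [a, b] is therefore the
    difference of the quotients of G at b and at a, which tend to f b and f a. *)
Lemma continuous_average_quotient f a b : continuous f -> a < b ->
  (fun n => \int[leb]_(t in `[a, b])
     ((harmonic n)^-1 * (f (harmonic n + t) - f t))%:E)%E @ \oo
  --> (f b - f a)%:E.
Proof.
move=> cf ab.
(* The primitive starts to the left of a, so that a is an inner point. *)
pose c := a - 1; pose G x := \int[leb]_(t in `[c, x]) f t.
have dG (x : R) : c < x -> derivable G x 1 /\ 'D_1 G x = f x.
  move=> cx; rewrite -derive1E.
  have xu : x < x + 1 by rewrite ltrDl.
  apply: (continuous_FTC1 xu) => //.
  - apply: continuous_compact_integrable; first exact: segment_compact.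
    exact: continuous_subspaceT.
  - exact: cf.
pose H n t := (harmonic n)^-1 * (G (harmonic n + t) - G t).
have dH n (t : R) : c < t -> is_derive t 1 (H n)
    ((harmonic n)^-1 * (f (harmonic n + t) - f t)).
  move=> ct.
  have ct' : c < harmonic n + t.
    by rewrite (lt_le_trans ct)// lerDr ltW// harmonic_gt0.
  have [d1 e1] := dG _ ct; have [d2 e2] := dG _ ct'.
  have h1 : is_derive t 1 G (f t) by exact: DeriveDef d1 e1.
  have h2 : is_derive t 1 (G \o (fun s => harmonic n + s)) (f (harmonic n + t)).
    have h3 : is_derive (harmonic n + t) 1 G (f (harmonic n + t)).
      exact: DeriveDef d2 e2.
    have h4 : is_derive t 1 (fun s : R => harmonic n + s) 1.
      by rewrite -[1 in X in is_derive _ _ _ X]add0r; exact: is_deriveD.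
    have := @is_derive1_comp _ G (fun s => harmonic n + s) t _ _ h3 h4.
    by rewrite mulr1.
  exact: is_deriveZ.
have E n : (\int[leb]_(t in `[a, b])
     ((harmonic n)^-1 * (f (harmonic n + t) - f t))%:E = (H n b - H n a)%:E)%E.
  have ca : c < a by rewrite /c ltrBlDr ltrDl.
  have cH t : a <= t -> {for t, continuous (H n)}.
    move=> at_; apply/differentiable_continuous/derivable1_diffP.
    by have [] := dH n t (lt_le_trans ca at_).
  rewrite EFinB; apply: continuous_FTC2 => //.
  - apply: continuous_subspaceT => t.
    apply: cvgM; first exact: cvg_cst.
    apply: cvgB; last exact: cf.
    apply: continuous_comp; last exact: cf.
    by apply: cvgD; [exact: cvg_cst|exact: cvg_id].
  - split.
    + move=> t; rewrite in_itv/= => /andP[/ltW at_ _].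
      by have [] := dH n t (lt_le_trans ca at_).
    + by apply: cvg_at_right_filter; exact: cH.
    + by apply: cvg_at_left_filter; apply: cH; exact: ltW.
  - move=> t; rewrite in_itv/= => /andP[/ltW at_ _].
    rewrite derive1E.
    by have [_ ->] := dH n t (lt_le_trans ca at_).
under eq_fun do rewrite E.
apply: cvg_EFin; first exact: nearW.
have lim x : a <= x -> (fun n => H n x) @ \oo --> f x.
  move=> ax; have cx : c < x by rewrite (lt_le_trans _ ax)// /c ltrBlDr ltrDl.
  have [dx <-] := dG x cx.
  rewrite /H; under eq_fun do rewrite -[X in G (X + _)]mulr1.
  exact: derivable_cvg_quotient dx.
by apply: cvgB; apply: lim => //; exact: ltW.
Qed.

(** The difference quotients of f are bounded by the Lipschitz constant and
    converge almost everywhere to g, so by dominated convergence their integrals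
    tend to that of g; by [continuous_average_quotient] they also tend to
    f b - f a. *)
Lemma lipschitz_FTC f g a b L : a < b -> {within `[a, b], continuous f} ->
  (forall x y, x \in `]a, b[ -> y \in `]a, b[ ->
     `|f x - f y| <= L * `|x - y|) ->
  measurable_fun `]a, b[ g ->
  {ae leb, forall t, t \in `]a, b[ -> derivable f t 1 /\ 'D_1 f t = g t} ->
  \int[leb]_(t in `]a, b[) g t = f b - f a.
Proof.
move=> ab cf lf mg dfg.
pose F t := f (clamp a b t).
have cF : continuous F.
  move=> t; rewrite /continuous_at.
  move/subspace_continuousP : cf => /(_ (clamp a b t)) cft.
  have tab : `[a, b]%classic (clamp a b t) by exact: (clamp_in _ (ltW ab)).
  apply: cvg_comp (cft tab).
  move=> A nA.
  have : \forall s \near t, (`[a, b]%classic (clamp a b s) -> A (clamp a b s)).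
    exact: (@clamp_cont a b t _ nA).
  by apply: filterS => s; apply; exact: (clamp_in _ (ltW ab)).
have FE t : t \in `[a, b] -> F t = f t by move=> tab; rewrite /F clamp_id.
have lF s t : `|F s - F t| <= `|L| * `|s - t|.
  apply: (@le_trans _ _ (`|L| * `|clamp a b s - clamp a b t|)); last first.
    by rewrite ler_wpM2l ?clamp_lip.
  rewrite /F -!FE ?clamp_in ?(ltW ab)//.
  apply: (@lipschitz_closed_itv F a b) => //; rewrite ?clamp_in ?(ltW ab)//.
  move=> x y xab yab; rewrite !FE; last 2 first.
  - exact: (subset_itv_oo_cc yab).
  - exact: (subset_itv_oo_cc xab).
  by rewrite (le_trans (lf _ _ xab yab))// ler_wpM2r// ler_norm.
have := continuous_average_quotient cF ab.
rewrite !FE ?in_itv/= ?lexx ?ltW//.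
pose q n t := (harmonic n)^-1 * (F (harmonic n + t) - F t).
rewrite -/(q _ _) => lim1.
have mq n : measurable_fun `]a, b[ (q n).
  apply: subspace_continuous_measurable_fun => //; apply: continuous_subspaceT => t.
  apply: cvgM; first exact: cvg_cst.
  apply: cvgB; last exact: cF.
  apply: continuous_comp; last exact: cF.
  by apply: cvgD; [exact: cvg_cst|exact: cvg_id].
have intL : leb.-integrable `]a, b[ (EFin \o cst `|L|).
  apply: measurable_bounded_integrable => //.
    have : (leb `]a, b[ < +oo)%E.
      by rewrite lebesgue_measure_itv/= lte_fin ab -EFinB ltry.
    exact.
  exact: bounded_cst.
have qL t n : `]a, b[%classic t -> (`|(q n t)%:E| <= `|L|%:E)%E.
  move=> _; rewrite lee_fin normrM ger0_norm; last first.
    by rewrite invr_ge0 ltW// harmonic_gt0.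
  rewrite mulrC ler_pdivrMr ?harmonic_gt0// (le_trans (lF _ _))//.
  by rewrite addrK (ger0_norm (ltW (harmonic_gt0 n))).
have qg : {ae leb, forall t, `]a, b[%classic t ->
    (q n t)%:E @[n --> \oo] --> (g t)%:E}.
  apply: ae_imp dfg => t dfgt tab; have [dft <-] := dfgt tab.
  apply: cvg_EFin; first exact: nearW.
  apply: cvg_trans (derivable_cvg_quotient dft); apply: near_eq_cvg.
  have hb : \forall n \near \oo, @harmonic R n < b - t.
    apply: (cvgr_lt (0 : R)); first exact: cvg_harmonic.
    by rewrite subr_gt0; move: tab; rewrite /= in_itv/= => /andP[].
  move: tab; rewrite /= in_itv/= => /andP[at_ tb].
  near=> n; rewrite /q !FE ?in_itv/= ?(ltW at_) ?(ltW tb)//.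
    by rewrite [X in f (X + t)]mulr1.
  rewrite (le_trans (ltW at_)) ?lerDr ?ltW ?harmonic_gt0//=.
  by rewrite -ltrBrDr; near: n.
have qL' : {ae leb, forall t n,
    `]a, b[%classic t -> (`|(q n t)%:E| <= `|L|%:E)%E}.
  by apply: aeW => t n; exact: qL.
have [_ _ lim2] := @dominated_convergence _ _ _ leb `]a, b[ (measurable_itv _)
  (fun n t => (q n t)%:E) (EFin \o g) (EFin \o cst `|L|)
  (fun n => (measurable_EFinP _ _).2 (mq n)) ((measurable_EFinP _ _).2 mg) qg
  intL qL'.
have lim1' : (\int[leb]_(t in `]a, b[) (q n t)%:E)%E @[n --> \oo]
    --> (f b - f a)%:E.
  apply: cvg_trans lim1; apply: near_eq_cvg; apply: nearW => n /=.
  rewrite integral_itv_bndoo//; apply/measurable_EFinP; exact: mq.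
by rewrite /Rintegral (cvg_unique _ lim2 lim1').
Unshelve. all: by end_near.
Qed.

End lipschitz_FTC.

(** * Measurability of directional derivatives *)

Section borel_rV.
Context {R : realType} {d : nat}.
Local Notation rV := 'rV[R]_d.
Implicit Types (A B C : set rV) (z : rV -> R) (v x : rV).

Lemma open_measurable_rV A : open A -> measurable A.
Proof. by move=> oA; exact: sub_sigma_algebra. Qed.

Lemma closed_measurable_rV A : closed A -> measurable A.
Proof.
move=> cA; rewrite -(setCK A); apply: measurableC; apply: open_measurable_rV.
exact: closed_openC.
Qed.

Lemma within_continuous_measurable_rV A z :
  measurable A -> {within A, continuous z} -> measurable_fun A z.
Proof.
move=> mA /continuousP cz; apply: (measurability _ (RGenOpens.measurableE R)).
move=> _ [_ [a [b ->] <-]].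
have : open (z @^-1` `]a, b[ : set (subspace A)) by exact/cz/interval_open.
move=> /open_subspaceP[V oV VA]; rewrite setIC -VA.
by apply: measurableI => //; exact: open_measurable_rV.
Qed.

Lemma closed_setI_preimage C z (D : set R) : closed C -> closed D ->
  (forall x, C x -> {for x, continuous z}) -> closed (C `&` z @^-1` D).
Proof.
move=> cC cD cz.
have : {within C, continuous z}.
  by apply: continuous_in_subspaceT => x /set_mem; exact: cz.
move=> /continuous_closedP/(_ _ cD)/closed_subspaceP[V cV VC].
by rewrite setIC -VC; exact: closedI.
Qed.

Lemma closed_inner_points A (r : R) : 0 < r -> closed [set x | ball x r `<=` A].
Proof.
move=> r0.
rewrite -openC.
have -> : ~` [set x | ball x r `<=` A] = \bigcup_(y in ~` A) ball y r.
  apply/seteqP; split => x /=.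
    by move=> /existsNP[y /not_implyP[xy Ay]]; exists y => //; exact: ball_sym.
  by move=> [y Ay yx] /(_ y (ball_sym yx)).
apply: bigcup_open => y _; exact: ball_open.
Qed.

End borel_rV.

Section shifts.
Context {R : realType} {V : normedModType R}.
Implicit Types v w x : V.

Lemma addl_continuous w : continuous (fun x => w + x).
Proof. by move=> x; apply: cvgD; [exact: cvg_cst|exact: cvg_id]. Qed.

Lemma scale_near0 v (r : R) : 0 < r ->
  \forall h \near (0 : R), ball (0 : V) r (h *: v).
Proof.
move=> r0; have : (h *: v @[h --> (0 : R)]) --> (0 : V).
  by rewrite -[X in _ --> X](scale0r v); apply: cvgZl; exact: cvg_id.
by apply; exact: nbhsx_ballx.
Qed.

Lemma cvg_harmonic_shift v x : (@harmonic R n *: v + x) @[n --> \oo] --> x.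
Proof.
rewrite -[X in _ --> X]add0r; apply: cvgD; last exact: cvg_cst.
by rewrite -(scale0r v); apply: cvgZl; exact: cvg_harmonic.
Qed.

Lemma for_continuousB (f g : V -> R) x : {for x, continuous f} ->
  {for x, continuous g} -> {for x, continuous (fun y => f y - g y)}.
Proof. by move=> cf cg; apply: cvgB; [exact: cf|exact: cg]. Qed.

Lemma quotient_continuous (f : V -> R) (h : R) w x : {for x, continuous f} ->
  {for (w + x), continuous f} ->
  {for x, continuous (fun y => h^-1 *: (f (w + y) - f y))}.
Proof.
move=> cx cwx; apply: cvgZr; apply: cvgB; last exact: cx.
by apply: continuous_comp; [exact: addl_continuous|exact: cwx].
Qed.

End shifts.

Section measurable_derive.
Context {R : realType} {d : nat}.
Local Notation rV := 'rV[R]_d.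
Variables (A : set rV) (z : rV -> R) (v : rV).
Hypotheses (oA : open A) (cz : forall x, A x -> {for x, continuous z}).

Let q (h : R) (x : rV) : R := h^-1 *: (z (h *: v + x) - z x).

Let q_cont h x : A x -> A (h *: v + x) -> {for x, continuous (q h)}.
Proof.
by move=> Ax Ahx; apply: quotient_continuous; exact: cz.
Qed.

Let small (r : R) := [set h : R | h != 0 /\ ball 0 r h /\ ball (0 : rV) r (h *: v)].

(** For x in [inner r] and h in [small r] the point x + h v stays in A, where z
    is continuous; thus the difference quotients are continuous on [inner r]. *)
Let inner r := [set x : rV | ball x r `<=` A].

(** The points where all quotients with steps below r differ by at most e. *)
Let cauchyset (r e : R) := \bigcap_(hk in small r `*` small r)
  (inner r `&` (fun x => q hk.1 x - q hk.2 x) @^-1` [set t | `|t| <= e]).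

Let small_near (r : R) : 0 < r -> \forall h \near (0 : R)^', small r h.
Proof.
move=> r0; near=> h; split; last split.
- by near: h; exact: nbhs_dnbhs_neq.
- by near: h; apply: nbhs_dnbhs; exact: nbhsx_ballx.
- by near: h; apply: nbhs_dnbhs; exact: scale_near0.
Unshelve. all: by end_near.
Qed.

Let small_ex (r : R) : 0 < r -> exists h, small r h.
Proof.
move=> /small_near nr; exact: (@filter_ex _ _ (Proper_dnbhs_numFieldType 0) _ nr).
Qed.

Let inner_shift r h x : inner r x -> small r h -> A (h *: v + x).
Proof.
move=> rx [_ [_ hv]]; apply: rx.
move: hv; rewrite -!ball_normE /= !sub0r !normrN => hv.
by rewrite opprD addrCA subrr addr0 normrN.
Qed.

Let inner_sub (r : R) x : 0 < r -> inner r x -> A x.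
Proof. by move=> r0; apply; exact: ballxx. Qed.

Let cauchyset_closed (r e : R) : 0 < r -> closed (cauchyset r e).
Proof.
move=> r0; apply: closed_bigI => -[h k] /= [hr kr].
apply: closed_setI_preimage; first exact: closed_inner_points r0.
  rewrite (_ : [set t | _] = Num.norm @^-1` [set t | t <= e])//.
  apply: closed_comp; last exact: closed_le.
  by move=> t _; exact: norm_continuous.
move=> x xr; have Ax := inner_sub r0 xr.
by apply: for_continuousB; apply: q_cont => //; exact: inner_shift xr _.
Qed.

(** Differentiability is the Cauchy condition for difference quotients, with
    tolerances and step bounds running through a countable sequence.  Each
    condition is closed as z is continuous, so the set is Borel although the
    steps range over a continuum. *)
Lemma derivable_setE : [set x | A x /\ derivable z x v] =
  \bigcap_j \bigcup_n (cauchyset (harmonic n) (harmonic j)).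
Proof.
apply/seteqP; split => x /=.
  move=> [Ax dx] j _.
  have /nbhs_ballP[r /= r0 rA] : nbhs x A by exact: open_nbhs_nbhs.
  have /cauchyP/(_ (harmonic j / 2)) : cauchy ((fun h => q h x) @ (0 : R)^').
    exact: cvg_cauchy.
  rewrite divr_gt0 ?harmonic_gt0// => /(_ isT)[l].
  rewrite /= nbhs_filterE /= => /nbhs_ballP[s /= s0 sl].
  have : \forall n \near \oo, harmonic n < Num.min r s.
    by apply: (cvgr_lt (0 : R)); [exact: cvg_harmonic|rewrite lt_min r0].
  move=> [n _ /(_ n (leqnn n))] /=; rewrite lt_min => /andP[nr ns].
  exists n => // -[h k] /= [[h0 [hn _]] [k0 [kn _]]]; split.
    by apply: subset_trans rA; apply: le_ball; exact: ltW.
  have {}hn := le_ball (ltW ns) hn; have {}kn := le_ball (ltW ns) kn.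
  have := sl _ hn h0; have := sl _ kn k0.
  rewrite -!ball_normE /= => k1 h1.
  rewrite (_ : _ - _ = (l - q k x) - (l - q h x)); last first.
    by ring.
  rewrite (le_trans (ler_normB _ _))//.
  by rewrite [leRHS]splitr lerD// ltW.
move=> cx.
have Ax : A x.
  have [n _ /= ] := cx 0%N I.
  have [h hn] := small_ex (harmonic_gt0 n).
  by move=> /(_ (h, h))/= [] // xn _; exact: inner_sub (harmonic_gt0 n) xn.
split => //; apply: cauchy_cvg; apply: cauchy_exP => e e0.
have [j je] : exists j, @harmonic R j < e.
  have : \forall n \near \oo, @harmonic R n < e.
    by apply: (cvgr_lt (0 : R)); [exact: cvg_harmonic|].
  by move=> [n _ /(_ n (leqnn n))]; exists n.
have [n _ /= nj] := cx j I.
have nn := small_near (harmonic_gt0 n).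
have [h hn] := small_ex (harmonic_gt0 n).
exists (q h x); move: nn; apply: filterS => k kn.
have [_ /= hk] := nj (h, k) (conj hn kn).
by rewrite -ball_normE /=; exact: le_lt_trans hk je.
Qed.

Lemma measurable_derivable_set : measurable [set x | A x /\ derivable z x v].
Proof.
rewrite derivable_setE; apply: bigcap_measurable => [|j _]; first by exists 0%N.
apply: bigcup_measurable => n _; apply: closed_measurable_rV.
exact: cauchyset_closed (harmonic_gt0 n).
Qed.

(** On the Borel set where z is differentiable, 'D_v z is a limit of continuous
    difference quotients; elsewhere it has the constant value [point] of a
    divergent limit. *)
Lemma measurable_derive : measurable_fun A (fun x => 'D_v z x).
Proof.
pose D := [set x | A x /\ derivable z x v].
have mD : measurable D := measurable_derivable_set.
have mA := open_measurable_rV oA.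
have -> : A = D `|` (A `\` D).
  by rewrite setUIr setUCr setIT; apply/esym/setUidr => x [].
apply/measurable_funU => //; first exact: measurableD.
split; last first.
  apply: (eq_measurable_fun (cst point)) => // x /set_mem[Ax Dx].
  by rewrite /= /derive dvgP// => dx; apply: Dx.
(* The n-th quotient is continuous where the shifted point stays in A. *)
pose S n := A `&` (fun x : rV => @harmonic R n *: v + x : rV) @^-1` A.
have oS n : open (S n).
  by apply: openI => //; apply: open_comp => // x _; exact: addl_continuous.
apply: (@measurable_fun_cvg _ _ _ _ (fun n => q (harmonic n) \_ (S n))).
  move=> n; apply/(measurable_restrict _ (open_measurable_rV (oS n)) mD).
  apply: (measurable_funS (open_measurable_rV (oS n))); first by move=> x [].
  apply: within_continuous_measurable_rV; first exact: open_measurable_rV.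
  by apply: continuous_in_subspaceT => x /set_mem[Ax]; exact: q_cont.
move=> x [Ax dx].
apply: cvg_trans (derivable_cvg_quotient dx); apply: near_eq_cvg.
have : \forall n \near \oo, A (harmonic n *: v + x).
  by apply: (@cvg_harmonic_shift _ _ v x); exact: open_nbhs_nbhs.
by apply: filterS => n An; rewrite patchE mem_set.
Qed.

End measurable_derive.

(** * Slices and components *)

Section slices.
Context {R : realType} {X Y W : normedModType R}.
Variables (f : X * Y -> W).

(** Partial derivatives on space-time and derivatives of slices are limits of
    the same quotients, hence agree even where the limits do not exist. *)
Lemma quotient_slicel (x v : X) (t : Y) :
  (fun h : R => h^-1 *: ((f \o shift (x, t)) (h *: (v, 0)) - f (x, t))) =
  (fun h : R => h^-1 *: (((fun y => f (y, t)) \o shift x) (h *: v) - f (x, t))).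
Proof.
apply/funext => h /=; congr (_ *: (f _ - _)).
by congr (_, _); rewrite /= scaler0 add0r.
Qed.

Lemma quotient_slicer (x : X) (t v : Y) :
  (fun h : R => h^-1 *: ((f \o shift (x, t)) (h *: (0, v)) - f (x, t))) =
  (fun h : R => h^-1 *: (((fun s => f (x, s)) \o shift t) (h *: v) - f (x, t))).
Proof.
apply/funext => h /=; congr (_ *: (f _ - _)).
by congr (_, _); rewrite /= scaler0 add0r.
Qed.

Lemma derivable_slicel (x v : X) (t : Y) :
  derivable f (x, t) (v, 0) -> derivable (fun y => f (y, t)) x v.
Proof. by rewrite /derivable quotient_slicel. Qed.

Lemma derive_slicel (x v : X) (t : Y) :
  'D_(v, 0) f (x, t) = 'D_v (fun y => f (y, t)) x.
Proof. by rewrite /derive quotient_slicel. Qed.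

Lemma derivable_slicer (x : X) (t v : Y) :
  derivable f (x, t) (0, v) -> derivable (fun s => f (x, s)) t v.
Proof. by rewrite /derivable quotient_slicer. Qed.

Lemma derive_slicer (x : X) (t v : Y) :
  'D_(0, v) f (x, t) = 'D_v (fun s => f (x, s)) t.
Proof. by rewrite /derive quotient_slicer. Qed.

End slices.

Section components.
Context {R : realType} {V : normedModType R} {n : nat}.
Variables (f : V -> 'cV[R]_n) (p v : V).

Lemma derivable_coord c : derivable f p v -> derivable (fun q => f q c 0) p v.
Proof. by move=> /derivable_mxP. Qed.

Lemma derive_coord c : derivable f p v ->
  'D_v (fun q => f q c 0) p = ('D_v f p) c 0.
Proof. by move=> df; rewrite derive_mx// mxE. Qed.

End components.

(** * The upwind projections on the time faces *)

Section spectral.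
Context {R : realType} {n : nat}.

(** Any diagonalization of a scalar matrix has the scalar as its only
    eigenvalue, so the diagonalization that is picked is immaterial. *)
Lemma spectral_fun_scalar (chi : R -> R) (c : R) :
  spectral_fun chi (c%:M : 'M[R]_n) = (chi c)%:M.
Proof.
apply: xget_unique.
  exists 1%:M, (const_mx c); split; first exact: unitmx1.
    by rewrite diag_const_mx mul1mx invmx1 mulmx1.
  by rewrite map_const_mx diag_const_mx mul1mx invmx1 mulmx1.
move=> Q [P [l [uP cE ->]]].
have lc : diag_mx l = c%:M.
  have <- : invmx P *m c%:M *m P = diag_mx l.
    by rewrite cE !mulmxA mulVmx// mul1mx mulmxKV.
  by rewrite mul_mx_scalar -scalemxAl mulVmx// scalemx1.
have -> : l = const_mx c.
  apply/rowP => j; have /matrixP/(_ j j) := lc.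
  by rewrite !mxE eqxx !mulr1n.
by rewrite map_const_mx diag_const_mx mul_mx_scalar -scalemxAl mulmxV// scalemx1.
Qed.

End spectral.

Section time_faces.
Context {R : realType} {d : nat}.
Implicit Types u : state R d.

Lemma nflux_time (c : R) u : nflux (0, c) u = c *: u.
Proof. by rewrite /nflux big1 ?add0r// => k _; rewrite mxE scale0r. Qed.

(** On the faces with normal (0, c) the space-time flux is linear; this is why
    the upwind projections there are I or 0. *)
Lemma nflux'_time (c : R) u : nflux' (0, c) u = c%:M.
Proof.
rewrite /nflux' /jacobian_mx; apply/matrixP => i j; rewrite !mxE.
have -> : nflux (0, c) = c \*: (id : state R d -> state R d).
  by apply/funext => w; exact: nflux_time.
rewrite deriveZ// derive_id !mxE eqxx andbT.
by case: eqVneq => _; rewrite /= ?mulr1 ?mulr0// mulr1n.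
Qed.

Lemma Pplus_final u : Pplus (0, 1) u = 1%:M.
Proof.
rewrite /Pplus /proj_plus nflux'_time spectral_fun_scalar.
by rewrite /chi_plus sgr1 max_r.
Qed.

Lemma Pminus_final u : Pminus (0, 1) u = 0.
Proof.
rewrite /Pminus /proj_minus nflux'_time spectral_fun_scalar.
by rewrite /chi_minus sgrN1 max_l ?raddf0 ?lerN10.
Qed.

Lemma Pplus_initial u : Pplus (0, -1) u = 0.
Proof.
rewrite /Pplus /proj_plus nflux'_time spectral_fun_scalar.
by rewrite /chi_plus sgrN1 max_l ?raddf0 ?lerN10.
Qed.

Lemma Pminus_initial u : Pminus (0, -1) u = 1%:M.
Proof.
rewrite /Pminus /proj_minus nflux'_time spectral_fun_scalar.
by rewrite /chi_minus opprK sgr1 max_r.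
Qed.

End time_faces.

(** * Lipschitz and continuous functions on products *)

Section normed_lemmas.
Context {R : realType}.

Lemma coord_le_norm n (w : 'cV[R]_n) c : `|w c 0| <= `|w|.
Proof.
rewrite [in leRHS]/Num.norm /= mx_normrE.
exact: (le_bigmax _ (fun ij => `|w ij.1 ij.2|) (c, 0)).
Qed.

Lemma norm_pairr (X Y : normedModType R) (x : X) (s t : Y) :
  `|(x, s) - (x, t)| = `|s - t|.
Proof. by rewrite prod_normE /= subrr normr0 max_r. Qed.

Lemma norm_pairl (X Y : normedModType R) (x y : X) (t : Y) :
  `|(x, t) - (y, t)| = `|x - y|.
Proof. by rewrite prod_normE /= subrr normr0 max_l. Qed.

Lemma segment_itvoo (a b s t r : R) : s \in `]a, b[ -> t \in `]a, b[ ->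
  0 <= r <= 1 -> s + r * (t - s) \in `]a, b[.
Proof.
rewrite !in_itv/= => /andP[as_ sb] /andP[at_ tb] /andP[r0 r1].
have [st|ts] := leP s t.
  have h1 := mulr_ge0 r0 (ltac:(lra) : 0 <= t - s).
  have h2 := mulr_ge0 (ltac:(lra) : 0 <= 1 - r) (ltac:(lra) : 0 <= t - s).
  by apply/andP; split; nra.
have h1 := mulr_ge0 r0 (ltac:(lra) : 0 <= s - t).
have h2 := mulr_ge0 (ltac:(lra) : 0 <= 1 - r) (ltac:(lra) : 0 <= s - t).
by apply/andP; split; nra.
Qed.

(** Short difference quotients at a point of the open set D only involve a
    segment inside D, so they are bounded by L |v|.  Where the limit does not
    exist its value is [point], hence the maximum in the bound. *)
Lemma derive_bounded (V W : normedModType R) (D : set V) (f : V -> W) v :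
  open D -> segment_lipschitz D f ->
  exists M : R, forall p, D p -> `|'D_v f p| <= M.
Proof.
move=> oD [L fL]; exists (Num.max (L * `|v|) `|point : W|) => p Dp.
rewrite le_max; have [df|ndf] := pselect (derivable f p v); last first.
  by rewrite /derive dvgP// lexx orbT.
apply/orP; left.
have cl : closed [set w : W | `|w| <= L * `|v|].
  have -> : [set w : W | `|w| <= L * `|v|] = Num.norm @^-1` [set r | r <= L * `|v|].
    by [].
  by apply: closed_comp; [move=> w _; exact: norm_continuous|exact: closed_le].
have /nbhs_ballP[r /= r0 rD] : nbhs p D by exact: open_nbhs_nbhs.
apply: (@closed_cvg _ _ _ _ _ _ cl _ _ df).
near=> h => /=.
have h0 : h != 0 by near: h; exact: nbhs_dnbhs_neq.
have hr : ball (0 : V) r (h *: v).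
  by near: h; apply: nbhs_dnbhs; exact: scale_near0.
have key : `|f (h *: v + p) - f p| <= L * `|h *: v|.
  rewrite distrC -[in leRHS](addrK p (h *: v)) [in leRHS]distrC.
  apply: fL => s /andP[s0 s1]; rewrite addrK.
  apply: rD; move: hr; rewrite -!ball_normE/= sub0r normrN => hr.
  rewrite opprD addrA subrr sub0r normrN normrZ ger0_norm//.
  by apply: le_lt_trans hr; rewrite ler_piMl.
rewrite normrZ normfV ler_pdivrMl ?normr_gt0//.
by rewrite mulrCA -normrZ.
Unshelve. all: by end_near.
Qed.

End normed_lemmas.

Section within_slices.
Context {R : realType}.

Lemma within_coord (X : topologicalType) (n : nat) (A : set X)
    (f : X -> 'cV[R]_n) c :
  {within A, continuous f} -> {within A, continuous (fun x => f x c 0)}.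
Proof.
move=> /subspace_continuousP cf; apply/subspace_continuousP => x Ax.
apply: (@cvg_comp _ _ _ f (fun w : 'cV[R]_n => w c 0) _ _ _ (cf x Ax)).
exact: coord_continuous.
Qed.

Lemma within_preimage (X Y Z : topologicalType) (A : set X) (D : set Y)
    (f : Y -> Z) (g : X -> Y) :
  {within D, continuous f} -> continuous g -> (forall x, A x -> D (g x)) ->
  {within A, continuous (f \o g)}.
Proof.
move=> /subspace_continuousP cf cg AD; apply/subspace_continuousP => x Ax.
apply: (@cvg_comp _ _ _ g f _ _ _ _ (cf _ (AD _ Ax))) => B nB.
have : \forall y \near x, (D (g y) -> B (g y)) by exact: (cg x _ nB).
by apply: filterS => y DB /AD; exact: DB.
Qed.

Lemma pairl_continuous (X Y : topologicalType) (t : Y) :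
  continuous (fun x : X => (x, t)).
Proof. by move=> x; apply: cvg_pair; [exact: cvg_id|exact: cvg_cst]. Qed.

Lemma pairr_continuous (X Y : topologicalType) (x : X) :
  continuous (fun t : Y => (x, t)).
Proof. by move=> t; apply: cvg_pair; [exact: cvg_cst|exact: cvg_id]. Qed.

Lemma closureX (X Y : topologicalType) (A : set X) (B : set Y) :
  closure (A `*` B) = closure A `*` closure B.
Proof.
apply/seteqP; split => -[x y] /=.
  move=> cxy; split => C nC.
    have nC' : nbhs (x, y) (fst @^-1` C).
      by exists (C, setT); [split => //; exact: filterT|move=> [? ?] []].
    by have [[x' y'] /= [[Ax _] Cx]] := cxy _ nC'; exists x'.
  have nC' : nbhs (x, y) (snd @^-1` C).
    by exists (setT, C); [split => //; exact: filterT|move=> [? ?] []].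
  by have [[x' y'] /= [[_ By] Cy]] := cxy _ nC'; exists y'.
move=> [cx cy] C [[P Q] /= [nP nQ] PQ].
have [x' [Ax Px]] := cx _ nP; have [y' [By Qy]] := cy _ nQ.
by exists (x', y'); split => //; exact: PQ.
Qed.

Lemma closure_itvoo (a b : R) : a < b -> closure `]a, b[ = `[a, b]%classic.
Proof.
move=> ab; apply/seteqP; split; first exact: itv_closure.
move=> x; rewrite /= in_itv/= => /andP[].
rewrite le_eqVlt => /predU1P[<- _|ax].
  move=> C nC; have : \forall z \near a^'+, C z /\ z \in `]a, b[.
    near=> z; split; first by near: z; exact: cvg_within.
    rewrite in_itv/=; apply/andP; split; near: z.
      exact: nbhs_right_gt.
    exact: nbhs_right_lt.
  by move=> /filter_ex[z [Cz zab]]; exists z.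
rewrite le_eqVlt => /predU1P[->|xb].
  move=> C nC; have : \forall z \near b^'-, C z /\ z \in `]a, b[.
    near=> z; split; first by near: z; exact: cvg_within.
    rewrite in_itv/=; apply/andP; split; near: z.
      exact: nbhs_left_gt.
    exact: nbhs_left_lt.
  by move=> /filter_ex[z [Cz zab]]; exists z.
by apply: subset_closure; rewrite /= in_itv/= ax.
Unshelve. all: by end_near.
Qed.

End within_slices.

(** * Test functions *)

Section test_function.
Context {R : realType} {d : nat}.
Variables (vol : {sigma_finite_measure set 'rV[R]_d -> \bar R}).
Variables (Omega : set 'rV[R]_d) (T : R) (phi : spacetime R d -> state R d).
Hypotheses (oOmega : open Omega) (T0 : 0 < T) (volOmega : (vol Omega < +oo)%E).
Hypothesis tphi : test_space vol Omega T phi.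
Local Notation ST := (spacetime R d).
Local Notation leb := (@lebesgue_measure R).
Local Notation stvol := (vol \x leb)%E.
Local Notation OT := (OmegaT Omega T).

Definition coordinate_direction (v : ST) := v = dir_t \/ exists k, v = dir_x k.

Lemma closure_OmegaT : closure OT = closure Omega `*` `[0, T]%classic.
Proof. by rewrite /OmegaT closureX closure_itvoo. Qed.

Lemma measurable_closure_OmegaT : measurable (closure OT).
Proof.
rewrite closure_OmegaT; apply: measurableX => //; apply: closed_measurable_rV.
exact: closed_closure.
Qed.

Lemma measurable_OmegaT : measurable OT.
Proof. by apply: measurableX => //; exact: open_measurable_rV. Qed.

Lemma open_OmegaT : open OT.
Proof.
rewrite openE => -[x t] [/= Ox tT]; exists (Omega, `]0, T[%classic) => //=.
by split; apply: open_nbhs_nbhs; split => //; exact: interval_open.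
Qed.

Lemma OmegaT_finite : (stvol OT < +oo)%E.
Proof.
have mO : measurable Omega by exact: open_measurable_rV.
rewrite /OmegaT product_measure1E// lte_mul_pinfty//.
  by rewrite ge0_fin_numE.
by have := lebesgue_measure_itv `]0, T[; rewrite /= lte_fin T0 => ->; rewrite -EFinB ltry.
Qed.

Lemma test_bounded :
  exists M : R, forall p c, closure OT p -> `|phi p c 0| <= M.
Proof.
case: tphi => _ cphi _ [K [cK KO phiK]].
have : compact (phi @` K).
  by apply: continuous_compact => //; exact: continuous_subspaceW cphi.
move=> /compact_bounded[M [_ /(_ (M + 1))]]; rewrite ltrDl ltr01 => /(_ isT) MK.
exists (Num.max (M + 1) 0) => p c cp; rewrite le_max.
have [Kp|Kp] := pselect (K p).
  by rewrite (le_trans (coord_le_norm _ _))//; apply: MK; exists p.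
by rewrite phiK// mxE normr0 lexx orbT.
Qed.

Lemma test_derive_bounded v : exists M : R, forall p c, OT p ->
  `|('D_v phi p) c 0| <= M.
Proof.
case: tphi => -[_ Lphi _ _ _] _ _ _.
have [M HM] := derive_bounded v open_OmegaT Lphi.
by exists M => p c Op; rewrite (le_trans (coord_le_norm _ _))//; exact: HM.
Qed.

Lemma test_measurable c D : measurable D -> D `<=` closure OT ->
  measurable_fun D (fun p => phi p c 0).
Proof.
move=> mD DO; case: tphi => _ _ mphi _.
exact: measurable_funS measurable_closure_OmegaT DO (mphi c).
Qed.

Lemma test_integrable (m : {sigma_finite_measure set 'rV[R]_d -> \bar R}) c D :
  measurable D -> ((m \x leb)%E D < +oo)%E -> D `<=` closure OT ->
  (m \x leb)%E.-integrable D (fun p => (phi p c 0)%:E).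
Proof.
move=> mD Dfin DO; apply: measurable_bounded_integrable => //.
  exact: test_measurable.
by have [M HM] := test_bounded; apply: (@bounded_on _ _ _ _ _ M) => p /DO; exact: HM.
Qed.

Lemma test_derive_measurable v c D : coordinate_direction v ->
  measurable D -> D `<=` OT -> measurable_fun D (fun p => ('D_v phi p) c 0).
Proof.
move=> dv mD DO; case: tphi => -[_ _ _ dphi _] _ _ _.
by apply: measurable_funS measurable_OmegaT DO _; have [_] := dphi v dv; apply.
Qed.

Lemma test_derive_integrable v c D : coordinate_direction v ->
  measurable D -> D `<=` OT ->
  stvol.-integrable D (fun p => (('D_v phi p) c 0)%:E).
Proof.
move=> dv mD DO; apply: measurable_bounded_integrable => //.
- apply: le_lt_trans OmegaT_finite; apply: le_measure => //; rewrite inE//.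
  exact: measurable_OmegaT.
- exact: test_derive_measurable.
have [M HM] := test_derive_bounded v.
by apply: (@bounded_on _ _ _ _ _ M) => p /DO; exact: HM.
Qed.

Lemma test_derivable_ae v : coordinate_direction v ->
  {ae stvol, forall p, OT p -> derivable phi p v}.
Proof. by move=> dv; case: tphi => -[_ _ _ dphi _] _ _ _; case: (dphi v dv). Qed.

Lemma section_measurable1 d1 d2 d3 (S1 : measurableType d1)
    (S2 : measurableType d2) (S3 : measurableType d3) (A : set S1) (B : set S2)
    (f : S1 * S2 -> S3) x : measurable A -> measurable B -> A x ->
  measurable_fun (A `*` B) f -> measurable_fun B (fun y => f (x, y)).
Proof.
move=> mA mB Ax mf; apply: (measurable_comp (F := A `*` B) (f := f)) => //.
- exact: measurableX.
- by move=> _ [y By <-].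
- exact: measurable_funTS (pair1_measurable x).
Qed.

Lemma section_measurable2 d1 d2 d3 (S1 : measurableType d1)
    (S2 : measurableType d2) (S3 : measurableType d3) (A : set S1) (B : set S2)
    (f : S1 * S2 -> S3) y : measurable A -> measurable B -> B y ->
  measurable_fun (A `*` B) f -> measurable_fun A (fun x => f (x, y)).
Proof.
move=> mA mB By mf; apply: (measurable_comp (F := A `*` B) (f := f)) => //.
- exact: measurableX.
- by move=> _ [x Ax <-].
- exact: measurable_funTS (pair2_measurable y).
Qed.

Section slab.
Variables (C : set 'rV[R]_d) (a b : R) (c : 'I_(1 + (d + 1))).
Hypotheses (mC : measurable C) (CO : C `<=` Omega).
Hypotheses (a0 : 0 <= a) (ab : a < b) (bT : b <= T).

Let slabOT : C `*` `]a, b[ `<=` OT.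
Proof.
move=> -[x t] [/= /CO Ox]; rewrite in_itv/= => /andP[at_ tb]; split => //=.
by rewrite in_itv/= (le_lt_trans a0 at_)/= (lt_le_trans tb bT).
Qed.

Let closed_slab x t : C x -> t \in `[a, b] -> closure OT (x, t).
Proof.
move=> /CO Ox; rewrite in_itv/= => /andP[at_ tb]; rewrite closure_OmegaT.
split => /=; first exact: subset_closure.
by rewrite in_itv/= (le_trans a0 at_)/= (le_trans tb bT).
Qed.

Lemma trace_integrable t : t \in `[0, T] ->
  vol.-integrable C (fun x => (phi (x, t) c 0)%:E).
Proof.
move=> tT; apply: measurable_bounded_integrable => //.
- apply: le_lt_trans volOmega; apply: le_measure => //; rewrite inE//.
  exact: open_measurable_rV.
- apply: (@section_measurable2 _ _ _ _ _ _ C `[0, T] (fun p => phi p c 0)) => //.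
  apply: test_measurable; first exact: measurableX.
  rewrite closure_OmegaT => -[x s] [/= /CO Ox sT]; split => //.
  exact: subset_closure.
have [M HM] := test_bounded.
apply: (@bounded_on _ _ _ _ _ M) => x Cx; apply: HM; rewrite closure_OmegaT.
by split => //=; exact/subset_closure/CO.
Qed.

(** On almost every vertical segment phi is Lipschitz with an almost everywhere
    defined derivative, and [lipschitz_FTC] applies; Fubini does the rest. *)
Lemma time_gauss_green :
  \int[stvol]_(p in C `*` `]a, b[) (d_t phi p) c 0
  = \int[vol]_(x in C) phi (x, b) c 0 - \int[vol]_(x in C) phi (x, a) c 0.
Proof.
have dt : coordinate_direction dir_t by left.
rewrite Rintegral_prodl//; last first.
  by apply: test_derive_integrable => //; exact: measurableX.
rewrite -RintegralB//; last 2 first.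
- by apply: trace_integrable; rewrite in_itv/= (le_trans a0 (ltW ab)) bT.
- by apply: trace_integrable; rewrite in_itv/= a0 (le_trans (ltW ab) bT).
apply: ae_eq_Rintegral.
have := ae_xsection (test_derivable_ae dt).
apply: ae_imp => x dx Cx.
case: tphi => -[_ [L Lphi] _ _ _] cphi _ _.
apply: (@lipschitz_FTC _ (fun t => phi (x, t) c 0) _ a b L) => //.
- apply: (within_coord (f := fun t => phi (x, t))).
  apply: (within_preimage (D := closure OT) (f := phi) (g := fun t => (x, t))) => //.
    exact: pairr_continuous.
  by move=> t tab; exact: closed_slab.
- move=> s t sab tab.
  rewrite (_ : _ - _ = (phi (x, s) - phi (x, t)) c 0); last by rewrite !mxE.
  rewrite (le_trans (coord_le_norm _ _))// -(norm_pairr x s t).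
  apply: Lphi => r r01; apply: slabOT; split => /=.
    by rewrite subrr scaler0 addr0.
  exact: segment_itvoo.
- apply: (@section_measurable1 _ _ _ _ _ _ C `]a, b[ (fun p => (d_t phi p) c 0)) => //.
  by apply: test_derive_measurable => //; exact: measurableX.
apply: ae_imp dx => t dxt tab.
have {}dxt : derivable phi (x, t) dir_t by apply/dxt/slabOT.
have dst := derivable_slicer dxt.
split; first exact: derivable_coord.
by rewrite (derive_coord c dst) /d_t /dir_t derive_slicer.
Qed.

End slab.

Variables (I E : finType) (G : grid R d I E).
Variables (area : {sigma_finite_measure set 'rV[R]_d -> \bar R}).
Hypothesis hspace : is_space_grid vol area G Omega.

Lemma cell_open i : open (cell G i).
Proof. by case: hspace => -[]. Qed.

Lemma cell_sub i : cell G i `<=` Omega.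
Proof. by case: hspace => -[]. Qed.

Lemma closure_cell_sub i : closure (cell G i) `<=` closure Omega.
Proof. exact/closureS/cell_sub. Qed.

Lemma face_sub i e : is_face G i e -> face G e `<=` closure (cell G i).
Proof.
case: hspace => _ [] /(_ i) ce _ _ _ _ _ _ ie x ex.
have : (\bigcup_(e0 in [set e0 | is_face G i e0]) face G e0) x by exists e.
by rewrite -ce => -[].
Qed.

Lemma face_measurable e : measurable (face G e).
Proof. by apply: closed_measurable_rV; case: hspace => _ [] _ cf *; exact: cf. Qed.

Lemma face_finite e : (area (face G e) < +oo)%E.
Proof. by case: hspace => _ [] _ _ ff *; exact: ff. Qed.

Section space.
Variables (i : I) (a b : R) (c : 'I_(1 + (d + 1))).
Hypotheses (a0 : 0 <= a) (ab : a < b) (bT : b <= T).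

Lemma stface_sub e (J : set R) : is_face G i e -> J `<=` `[0, T] ->
  face G e `*` J `<=` closure OT.
Proof.
move=> ie JT [x t] [/= ex Jt]; rewrite closure_OmegaT; split; last exact: JT.
exact: (closure_cell_sub (face_sub ie ex)).
Qed.

Lemma face_trace_integrable e (J : set R) : is_face G i e -> measurable J ->
  J `<=` `[0, T] ->
  (area \x leb)%E.-integrable (face G e `*` J) (fun p => (phi p c 0)%:E).
Proof.
move=> ie mJ JT; apply: test_integrable; last exact: stface_sub.
  by apply: measurableX => //; exact: face_measurable.
rewrite product_measure1E//; last exact: face_measurable.
rewrite lte_mul_pinfty//.
  by rewrite ge0_fin_numE// face_finite.
have : (leb J < +oo)%E.
  apply: (@le_lt_trans _ _ (leb `[0, T]%classic)).
    by apply: le_measure => //; rewrite inE.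
  by rewrite lebesgue_measure_itv/= lte_fin T0 -EFinB ltry.
exact.
Qed.

(** For almost every t the slice of phi is an admissible test function for the
    Gauss-Green formula of the cell.  Its derivative is measurable by
    [measurable_derive], and integrating over t gives the integrals over the
    lateral faces by Fubini for the surface measure. *)
Lemma space_gauss_green k :
  \int[stvol]_(p in cell G i `*` `]a, b[) (d_x k phi p) c 0
  = \sum_(e | is_face G i e) onormal G i e 0 k *
      \int[(area \x leb)%E]_(p in face G e `*` `]a, b[) phi p c 0.
Proof.
have dk : coordinate_direction (dir_x k) by right; exists k.
have mC : measurable (cell G i) by apply: open_measurable_rV; exact: cell_open.
have abT : `]a, b[ `<=` `[0, T].
  move=> t; rewrite /= !in_itv/= => /andP[at_ tb].
  by rewrite (le_trans a0 (ltW at_)) (le_trans (ltW tb) bT).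
have slabOT : cell G i `*` `]a, b[ `<=` OT.
  move=> -[x t] [/= /cell_sub Ox]; rewrite in_itv/= => /andP[at_ tb]; split => //=.
  by rewrite in_itv/= (le_lt_trans a0 at_)/= (lt_le_trans tb bT).
rewrite Rintegral_prodr//; last first.
  by apply: test_derive_integrable => //; exact: measurableX.
have intF e : is_face G i e ->
    leb.-integrable `]a, b[ (fun t => (\int[area]_(x in face G e) phi (x, t) c 0)%:E).
  move=> ie; have mI : measurable (`]a, b[%classic : set R) by [].
  exact: (@integrable_prodr _ _ _ _ _ area leb (face G e) `]a, b[
    (fun p => phi p c 0) (face_measurable e) mI (face_trace_integrable ie mI abT)).
transitivity (\int[leb]_(t in `]a, b[) \sum_(e | is_face G i e)
    onormal G i e 0 k * \int[area]_(x in face G e) phi (x, t) c 0); last first.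
  rewrite Rintegral_sum//; last by move=> e ie; apply: integrable_RZl => //; exact: intF.
  apply: eq_bigr => e ie; rewrite RintegralZl//; last exact: intF.
  congr (_ * _); rewrite Rintegral_prodr//; first exact: face_measurable.
  exact: face_trace_integrable.
apply: ae_eq_Rintegral.
have := ae_ysection (test_derivable_ae dk).
apply: ae_imp => t dt tab.
have tT : t \in `]0, T[.
  move: tab; rewrite !in_itv/= => /andP[at_ tb].
  by rewrite (le_lt_trans a0 at_)/= (lt_le_trans tb bT).
pose z (x : 'rV[R]_d) : R := phi (x, t) c 0.
have gg : gauss_green vol area G i by case: hspace => _ _ _ [].
have dphi : {ae vol, forall x, cell G i x -> derivable phi (x, t) (dir_x k)}.
  by apply: ae_imp dt => x dx Cx; apply: dx; split => //=; exact: cell_sub Cx.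
have cphi : {within closure (cell G i), continuous z}.
  case: tphi => _ cphi _ _; apply: (within_coord (f := fun x => phi (x, t))).
  apply: (within_preimage (D := closure OT) (f := phi) (g := fun x => (x, t))) => //.
    exact: pairl_continuous.
  move=> x Cx; rewrite closure_OmegaT; split; first exact: closure_cell_sub Cx.
  exact: abT.
rewrite -gg //.
- apply: ae_eq_Rintegral; apply: ae_imp dphi => x dx Cx.
  have dst := derivable_slicel (dx Cx).
  by rewrite (derive_coord c dst) /d_x /dir_x derive_slicel.
- case: tphi => _ _ _ [K [cK KO phiK]]; exists (fst @` K); split.
    apply: continuous_compact => //; apply: continuous_subspaceT => p.
    exact: cvg_fst.
  move=> x Cx Kx; rewrite /z phiK ?mxE//.
    rewrite closure_OmegaT; split; first exact: closure_cell_sub Cx.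
    exact: abT.
  by move=> Kxt; apply: Kx; exists (x, t).
- case: tphi => -[_ [L Lphi] _ _ _] _ _ _; exists L => x y xy.
  rewrite (_ : _ - _ = (phi (x, t) - phi (y, t)) c 0); last by rewrite !mxE.
  rewrite (le_trans (coord_le_norm _ _))// -(norm_pairl x y t).
  apply: Lphi => r r01; split => /=; first exact/cell_sub/xy.
  by rewrite subrr scaler0 addr0.
- apply: (ae_imp _ dphi) => x dx Cx.
  exact: derivable_coord (derivable_slicel (dx Cx)).
- apply: measurable_derive; first exact: cell_open.
  move=> x Cx; have := continuous_subspaceW (@subset_closure _ (cell G i)) cphi.
  rewrite continuous_open_subspace; last exact: cell_open.
  by move=> /(_ x (mem_set Cx)).
Qed.

End space.

End test_function.

(** * Pairings with vector-valued functions *)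

Section dot_product.
Context {R : realType} {n : nat}.
Implicit Types a b w : 'cV[R]_n.

Lemma dotDl a b w : dot (a + b) w = dot a w + dot b w.
Proof. by rewrite -big_split; apply: eq_bigr => c _; rewrite mxE mulrDl. Qed.

Lemma dotZl (r : R) a w : dot (r *: a) w = r * dot a w.
Proof. by rewrite mulr_sumr; apply: eq_bigr => c _; rewrite mxE mulrA. Qed.

Lemma dotNl a w : dot (- a) w = - dot a w.
Proof. by rewrite -scaleN1r dotZl mulN1r. Qed.

Lemma dotBl a b w : dot (a - b) w = dot a w - dot b w.
Proof. by rewrite dotDl dotNl. Qed.

Lemma dot0l w : dot 0 w = 0.
Proof. by rewrite -(scale0r w) dotZl mul0r. Qed.

Lemma dotC a b : dot a b = dot b a.
Proof. by apply: eq_bigr => c _; rewrite mulrC. Qed.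

Lemma dotDr a b w : dot w (a + b) = dot w a + dot w b.
Proof. by rewrite !(dotC w) dotDl. Qed.

Lemma dotBr a b w : dot w (a - b) = dot w a - dot w b.
Proof. by rewrite !(dotC w) dotBl. Qed.

Lemma dotZr (r : R) a w : dot w (r *: a) = r * dot w a.
Proof. by rewrite !(dotC w) dotZl. Qed.

Lemma dot0r w : dot w 0 = 0. Proof. by rewrite dotC dot0l. Qed.

Lemma dot_suml (J : Type) (s : seq J) (P : pred J) (F : J -> 'cV[R]_n) w :
  dot (\sum_(j <- s | P j) F j) w = \sum_(j <- s | P j) dot (F j) w.
Proof.
by elim/big_rec2 : _ => [|j x y _ <-]; rewrite ?dot0l ?dotDl.
Qed.

(** The duality that moves A_k from U - U_h to the gradient of phi. *)
Lemma dot_mulmx (M : 'M[R]_n) a w : dot (M *m a) w = dot a (M^T *m w).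
Proof.
rewrite /dot; under eq_bigr do rewrite mxE mulr_suml.
rewrite exchange_big; apply: eq_bigr => c _; rewrite mxE mulr_sumr.
by apply: eq_bigr => k _; rewrite mxE mulrCA mulrA.
Qed.

Lemma dot_eq0 a : (forall w, dot a w = 0) -> a = 0.
Proof.
move=> a0; apply/colP => c; rewrite mxE -(a0 (delta_mx c 0)) /dot.
rewrite (bigD1 c)//= big1 ?addr0; first by rewrite mxE !eqxx mulr1.
by move=> j jc; rewrite mxE (negbTE jc) mulr0.
Qed.

End dot_product.

Section vector_integrals.
Context dd (S : measurableType dd) (R : realType) (n : nat).
Variable mu : {measure set S -> \bar R}.
Implicit Types (D : set S) (h : S -> 'cV[R]_n).

Definition vintegrable D h := forall c, mu.-integrable D (fun x => (h x c 0)%:E).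

Lemma vintegrableB D h1 h2 : measurable D -> vintegrable D h1 ->
  vintegrable D h2 -> vintegrable D (fun x => h1 x - h2 x).
Proof.
move=> mD i1 i2 c; apply: (eq_integrable mD (fun x => (h1 x c 0 - h2 x c 0)%:E)).
  by move=> x _; rewrite !mxE.
exact: (integrable_RB mD (i1 c) (i2 c)).
Qed.

Lemma vintegrable_cst D (w : 'cV[R]_n) : measurable D -> (mu D < +oo)%E ->
  vintegrable D (fun=> w).
Proof.
move=> mD Dfin c; apply: measurable_bounded_integrable => //.
exact: bounded_cst.
Qed.

Lemma vintegrable_mulmx D h (M : 'M[R]_n) : measurable D -> vintegrable D h ->
  vintegrable D (fun x => M *m h x).
Proof.
move=> mD ih c.
apply: (eq_integrable mD (fun x => (\sum_k M c k * h x k 0)%:E)).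
  by move=> x _; rewrite mxE.
by apply: integrable_Rsum => // k _; exact: (integrable_RZl _ mD (ih k)).
Qed.

Lemma integrable_dotr D (u : 'cV[R]_n) h : measurable D -> vintegrable D h ->
  mu.-integrable D (fun x => (dot u (h x))%:E).
Proof.
by move=> mD ih; apply: integrable_Rsum => // c _; exact: (integrable_RZl _ mD (ih c)).
Qed.

Lemma integrable_dot_bounded D h (w : S -> 'cV[R]_n) (M : R) :
  measurable D -> vintegrable D h ->
  (forall c, measurable_fun D (fun x => w x c 0)) ->
  (forall x c, D x -> `|w x c 0| <= M) ->
  mu.-integrable D (fun x => (dot (h x) (w x))%:E).
Proof.
move=> mD ih mw wM; apply: integrable_Rsum => // c _.
exact: (integrable_RMr mD (ih c) (mw c) (fun x Dx => wM x c Dx)).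
Qed.

Lemma Rintegral_dotr D (u : 'cV[R]_n) h : measurable D -> vintegrable D h ->
  \int[mu]_(x in D) dot u (h x) = dot u (vintegral mu D h).
Proof.
move=> mD ih; rewrite Rintegral_sum//; last first.
  by move=> c _; exact: (integrable_RZl _ mD (ih c)).
by apply: eq_bigr => c _; rewrite (RintegralZl _ mD (ih c)) mxE.
Qed.

Lemma vintegralB D h1 h2 : measurable D -> vintegrable D h1 ->
  vintegrable D h2 ->
  vintegral mu D (fun x => h1 x - h2 x) = vintegral mu D h1 - vintegral mu D h2.
Proof.
move=> mD i1 i2; apply/colP => c; rewrite !mxE -(RintegralB mD (i1 c) (i2 c)).
by apply: eq_Rintegral => x _; rewrite !mxE.
Qed.

Lemma vintegral_cst D (w : 'cV[R]_n) : measurable D ->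
  vintegral mu D (fun=> w) = fine (mu D) *: w.
Proof. by move=> mD; apply/colP => c; rewrite !mxE Rintegral_cst// mulrC. Qed.

End vector_integrals.

Section closed_time_intervals.
Context dd (S : measurableType dd) (R : realType).
Variable m : {sigma_finite_measure set S -> \bar R}.
Local Notation leb := (@lebesgue_measure R).

Lemma product_null_time (a b : R) :
  (m \x leb)%E.-negligible (setT `*` [set a; b]).
Proof.
have mab : measurable ([set a; b] : set R) by apply: measurableU.
have l0 : (leb [set a; b] = 0)%E.
  by apply: countable_lebesgue_measure0; exact/finite_set_countable/finite_set2.
have E : ((m \x leb)%E (setT `*` [set a; b]) = 0)%E.
  by rewrite product_measure1E// [X in (_ * X)%E](_ : _ = 0%E) ?mule0.
by apply/negligibleP => //; exact: measurableX.
Qed.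

(** The cells are closed in time whereas Omega_T is open, and the integrand may
    be known, or integrable, on the open interval only. *)
Lemma Rintegral_open_time (F : set S) (a b : R) (f : S * R -> R) :
  \int[(m \x leb)%E]_(p in F `*` `[a, b]) f p =
  \int[(m \x leb)%E]_(p in F `*` `]a, b[) f p.
Proof.
apply: negligible_sub_Rintegral.
  by move=> [x t] [/= Fx tab]; split => //=; exact: (subset_itv_oo_cc tab).
apply: negligibleS (product_null_time a b) => -[x t] [[/= Fx]].
rewrite !in_itv/= => /andP[at_ tb] nab; split => //=.
move: at_ tb; rewrite le_eqVlt => /predU1P[->|at_]; first by left.
rewrite le_eqVlt => /predU1P[->|tb]; first by right.
by exfalso; apply: nab; rewrite at_ tb.
Qed.

End closed_time_intervals.

(** * Measures of the cells and faces of the grid *)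

Section grid_integrals.
Context {R : realType} {d : nat} {I E : finType}.
Variables (vol area : {sigma_finite_measure set 'rV[R]_d -> \bar R}).
Variables (Omega : set 'rV[R]_d) (T : R) (G : grid R d I E).
Hypotheses (oOmega : open Omega) (T0 : 0 < T).
Hypotheses (hspace : is_space_grid vol area G Omega) (htime : is_time_grid G T).
Local Notation ST := (spacetime R d).
Local Notation leb := (@lebesgue_measure R).
Local Notation starea := (area \x leb)%E.
Local Notation N := (nsteps G).

Lemma cell_measurable i : measurable (cell G i).
Proof. by apply: open_measurable_rV; exact: cell_open hspace i. Qed.

Lemma cell_finite i : (vol (cell G i) < +oo)%E.
Proof. by case: hspace => -[_ /(_ i) /andP[]]. Qed.

Lemma cvol_gt0 i : 0 < cvol vol G i.
Proof.
case: hspace => -[_ /(_ i) /andP[v0 vi] _ _ _] _ _ _.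
by rewrite /cvol fine_gt0// v0.
Qed.

Lemma face_null e : vol (face G e) = 0%E.
Proof. by case: hspace => _ [_ _ _ fn _] _ _; exact: fn. Qed.

Lemma closure_cell_faces i x : closure (cell G i) x ->
  cell G i x \/ exists2 e, is_face G i e & face G e x.
Proof.
case: hspace => _ [/(_ i) ce _ _ _ _] _ _ cx.
have [|nx] := pselect (cell G i x); [by left|right].
have : (closure (cell G i) `\` cell G i) x by [].
by rewrite ce => -[e ie ex]; exists e.
Qed.

Lemma closure_Omega_cover x : closure Omega x ->
  (exists i, cell G i x) \/ exists e, face G e x.
Proof.
case: (hspace) => -[_ _ _ _ ->] _ _ _ [i _ /closure_cell_faces[ix|[e _ ex]]].
  by left; exists i.
by right; exists e.
Qed.

Lemma null_face_union : vol.-negligible (\bigcup_(e in [set: E]) face G e).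
Proof.
have -> : \bigcup_(e in [set: E]) face G e = \big[setU/set0]_(e : E) face G e.
  rewrite -bigcup_seq; congr (\bigcup_(e in _) _).
  by apply/seteqP; split => e //= _; exact: mem_index_enum.
elim/big_ind : _ => [|X Y|e _]; first exact: negligible_set0.
  exact: negligibleU.
by apply/negligibleP; [exact: face_measurable hspace e|exact: face_null].
Qed.

(** Up to null sets Omega is a union of finitely many cells of finite volume. *)
Lemma Omega_finite : (vol Omega < +oo)%E.
Proof.
have mO : measurable Omega by exact: open_measurable_rV.
have [K [mK K0 fK]] := null_face_union.
have fin : measurable (\big[setU/set0]_(i : I) cell G i) /\
           (vol (\big[setU/set0]_(i : I) cell G i) < +oo)%E.
  elim/big_ind : _ => [|X Y [mX fX] [mY fY]|i _].
  - by rewrite measure0.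
  - split; first exact: measurableU.
    by apply: (le_lt_trans (measureU2 vol mX mY)); exact: lte_add_pinfty.
  - by split; [exact: cell_measurable|exact: cell_finite].
case: fin => mU fU.
apply: (@le_lt_trans _ _ (vol (\big[setU/set0]_(i : I) cell G i `|` K))).
  apply: le_measure; rewrite ?inE//; first exact: measurableU.
  move=> x Ox; have [[i ix]|[e ex]] := closure_Omega_cover (subset_closure Ox).
    by left; rewrite -bigcup_seq; exists i => //=; rewrite mem_index_enum.
  by right; apply: fK; exists e.
apply: (le_lt_trans (measureU2 vol mU mK)).
by rewrite [X in (_ + X)%E]K0 adde0.
Qed.

Lemma tm_le m n : (m <= n <= N)%N -> tm G m <= tm G n.
Proof.
case: htime => _ _ _ tS /andP[]; elim: n => [|n IH].
  by rewrite leqn0 => /eqP ->.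
rewrite leq_eqVlt => /predU1P[->//|]; rewrite ltnS => mn nN.
by rewrite (le_trans (IH mn (ltnW nN)))// ltW// tS.
Qed.

Lemma tm_step m : (1 <= m <= N)%N ->
  [/\ 0 <= tm G m.-1, tm G m.-1 < tm G m & tm G m <= T].
Proof.
move=> /andP[m1 mN]; case: (htime) => _ t0 tN tS; split.
- by rewrite -t0; apply: tm_le; rewrite leq0n/= (leq_trans (leq_pred _)).
- by case: m m1 mN => // m _ mN; exact: tS.
- by rewrite -tN; apply: tm_le; rewrite mN leqnn.
Qed.

Lemma dtm_gt0 m : (1 <= m <= N)%N -> 0 < dtm G m.
Proof. by move=> /tm_step[_ h _]; rewrite subr_gt0. Qed.

Lemma Im_sub m : (1 <= m <= N)%N -> Defs.Im G m `<=` `[0, T].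
Proof.
move=> /tm_step[t0 _ tT] t; rewrite /Defs.Im/= !in_itv/= => /andP[h1 h2].
by rewrite (le_trans t0 h1) (le_trans h2 tT).
Qed.

Lemma Im_measure m : (1 <= m <= N)%N -> (leb (Defs.Im G m) = (dtm G m)%:E)%E.
Proof.
by move=> /tm_step[_ h _]; rewrite /Defs.Im lebesgue_measure_itv/= lte_fin h EFinB.
Qed.

Lemma stface_measurable e m :
  measurable (face G e `*` (Defs.Im G m : set (measurableTypeR R))).
Proof.
apply: measurableX; first exact: face_measurable hspace e.
exact: measurable_itv.
Qed.

Lemma stface_measure e m : (1 <= m <= N)%N ->
  (starea (face G e `*` Defs.Im G m) = (farea area G e * dtm G m)%:E)%E.
Proof.
move=> mN; rewrite product_measure1E; last 2 first.
- exact: face_measurable hspace e.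
- exact: measurable_itv.
rewrite [X in (_ * X)%E](_ : _ = (dtm G m)%:E); last exact: Im_measure.
by rewrite EFinM fineK// ge0_fin_numE//; exact: face_finite hspace e.
Qed.

Definition trace_integrable_on i m (w : ST -> state R d) :=
  [/\ forall e, is_face G i e -> vintegrable starea (face G e `*` Defs.Im G m) w,
      vintegrable vol (cell G i) (fun x => w (x, tm G m))
    & vintegrable vol (cell G i) (fun x => w (x, tm G m.-1))].

Definition lat_trace e m (w : ST -> state R d) :=
  vintegral starea (face G e `*` Defs.Im G m) w.
Definition level_trace i m (w : ST -> state R d) :=
  vintegral vol (cell G i) (fun x => w (x, tm G m)).

(** The flux is constant on each face, so that only the integral of w over the
    face matters. *)
Lemma bdpairE i m q w : trace_integrable_on i m w ->
  bdpair vol area G i m q w =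
  \sum_(e | is_face G i e) dot (q (Lat e)) (lat_trace e m w)
  + dot (q Top) (level_trace i m w) + dot (q Bot) (level_trace i m.-1 w).
Proof.
case=> il it ib; rewrite /bdpair; congr (_ + _ + _).
- apply: eq_bigr => e ie; apply: Rintegral_dotr; first exact: stface_measurable.
  exact: il.
- by apply: Rintegral_dotr it; exact: cell_measurable.
- by apply: Rintegral_dotr ib; exact: cell_measurable.
Qed.

Lemma bdpairBr i m q w1 w2 : trace_integrable_on i m w1 ->
  trace_integrable_on i m w2 ->
  bdpair vol area G i m q (fun p => w1 p - w2 p) =
  bdpair vol area G i m q w1 - bdpair vol area G i m q w2.
Proof.
move=> i1 i2; have [l1 t1 b1] := i1; have [l2 t2 b2] := i2.
rewrite [LHS]bdpairE; last first.
  split; first (move=> e ie; apply: vintegrableB;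
    [exact: stface_measurable|exact: l1|exact: l2]).
  - by apply: (vintegrableB (cell_measurable i) t1 t2).
  - by apply: (vintegrableB (cell_measurable i) b1 b2).
rewrite !bdpairE//.
rewrite /level_trace (vintegralB (cell_measurable i) t1 t2).
rewrite (vintegralB (cell_measurable i) b1 b2) !dotBr.
rewrite (eq_bigr (fun e => dot (q (Lat e)) (lat_trace e m w1)
                         - dot (q (Lat e)) (lat_trace e m w2))); last first.
  move=> e ie; rewrite -dotBr /lat_trace -vintegralB//.
  - exact: stface_measurable.
  - exact: l1.
  - exact: l2.
by rewrite sumrB; ring.
Qed.

Lemma bdpairBl i m q1 q2 w : trace_integrable_on i m w ->
  bdpair vol area G i m (fun s => q1 s - q2 s) w =
  bdpair vol area G i m q1 w - bdpair vol area G i m q2 w.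
Proof.
move=> iw; rewrite !bdpairE// !dotBl.
under eq_bigr do rewrite dotBl.
by rewrite sumrB; ring.
Qed.

Lemma cst_trace_integrable i m (w : state R d) : (1 <= m <= N)%N ->
  trace_integrable_on i m (fun=> w).
Proof.
move=> mN; split.
- move=> e ie; apply: vintegrable_cst; first exact: stface_measurable.
  have : (starea (face G e `*` Defs.Im G m) < +oo)%E.
    by rewrite stface_measure// ltry.
  exact.
- by apply: vintegrable_cst; [exact: cell_measurable|exact: cell_finite].
- by apply: vintegrable_cst; [exact: cell_measurable|exact: cell_finite].
Qed.

Lemma bdpair_cst i m q (w : state R d) : (1 <= m <= N)%N ->
  bdpair vol area G i m q (fun=> w) =
  dot (dtm G m *: (\sum_(e | is_face G i e) farea area G e *: q (Lat e))
       + cvol vol G i *: (q Top + q Bot)) w.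
Proof.
move=> mN; rewrite bdpairE; last exact: cst_trace_integrable.
rewrite /level_trace vintegral_cst; last exact: cell_measurable.
rewrite dotDl !dotZl dotDl dot_suml !dotZr mulrDr -addrA; congr (_ + _).
rewrite mulr_sumr; apply: eq_bigr => e ie.
rewrite /lat_trace vintegral_cst; last exact: stface_measurable.
rewrite dotZl dotZr mulrA; congr (_ * _).
by have /(congr1 fine)/= := stface_measure e mN; rewrite mulrC.
Qed.

Lemma nflux_lat i e (u : state R d) :
  nflux (onormal G i e, 0) u = \sum_(k < d) onormal G i e 0 k *: eflux k u.
Proof. by rewrite /nflux scale0r addr0. Qed.

(** A constant state produces no net flux out of a cell: top and bottom cancel,
    and the area vectors of the faces of V_i sum to zero. *)
Lemma bdpair_nflux_cst i m u w : (1 <= m <= N)%N ->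
  bdpair vol area G i m (fun s => nflux (stnormal G i s) u) (fun=> w) = 0.
Proof.
move=> mN; rewrite bdpair_cst//= !nflux_time scaleN1r scale1r subrr scaler0 addr0.
rewrite (_ : \sum_(e | _) _ = 0) ?scaler0 ?dot0l//.
under eq_bigr do rewrite nflux_lat scaler_sumr.
rewrite exchange_big big1// => k _.
under eq_bigr do rewrite scalerA.
rewrite -scaler_suml.
have [_ _ _ [_ _ _ /(_ i) ng]] := hspace.
have /rowP/(_ k) := ng; rewrite summxE mxE.
under eq_bigr do rewrite mxE.
by move=> ->; rewrite scale0r.
Qed.

End grid_integrals.

(** * The Gauss-Green formula on a space-time cell *)

Section test_on_grid.
Context {R : realType} {d : nat} {I E : finType}.
Variables (vol area : {sigma_finite_measure set 'rV[R]_d -> \bar R}).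
Variables (Omega : set 'rV[R]_d) (T : R) (G : grid R d I E).
Hypotheses (oOmega : open Omega) (T0 : 0 < T).
Hypotheses (hspace : is_space_grid vol area G Omega) (htime : is_time_grid G T).
Variable phi : spacetime R d -> state R d.
Hypothesis tphi : test_space vol Omega T phi.
Local Notation leb := (@lebesgue_measure R).
Local Notation stvol := (vol \x leb)%E.
Local Notation starea := (area \x leb)%E.
Local Notation OT := (OmegaT Omega T).
Local Notation N := (nsteps G).

Let volfin : (vol Omega < +oo)%E := Omega_finite oOmega hspace.
Let mcell i : measurable (cell G i) := cell_measurable hspace i.
Let mface e : measurable (face G e) := face_measurable hspace e.

Lemma test_trace_integrable i m : (1 <= m <= N)%N ->
  trace_integrable_on vol area G i m phi.
Proof.
move=> mN; have [t0 tt tT] := tm_step htime mN; split.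
- move=> e ie c.
  have mI : measurable (Defs.Im G m : set (measurableTypeR R)) by exact: measurable_itv.
  exact: (face_trace_integrable T0 tphi hspace c ie
    mI (Im_sub htime mN)).
- move=> c; apply: (trace_integrable oOmega T0 volfin tphi c (mcell i)).
    exact: cell_sub hspace i.
  by rewrite in_itv/= tT (le_trans t0 (ltW tt)).
- move=> c; apply: (trace_integrable oOmega T0 volfin tphi c (mcell i)).
    exact: cell_sub hspace i.
  by rewrite in_itv/= t0 (le_trans (ltW tt) tT).
Qed.

(** The interior of V_i^m; its closure in time leaves Omega_T at t = 0 and
    t = T. *)
Definition slab i m : set (_ * measurableTypeR R) :=
  cell G i `*` `]tm G m.-1, tm G m[.

Lemma slab_measurable i m : measurable (slab i m).
Proof. by apply: measurableX. Qed.

Lemma slab_sub i m : (1 <= m <= N)%N -> slab i m `<=` OT.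
Proof.
move=> mN [x t] [/= /(cell_sub hspace) Ox]; have [t0 tt tT] := tm_step htime mN.
rewrite in_itv/= => /andP[h1 h2]; split => //=.
by rewrite in_itv/= (le_lt_trans t0 h1) (lt_le_trans h2 tT).
Qed.

Lemma slab_derive_integrable i m v : (1 <= m <= N)%N ->
  coordinate_direction v -> vintegrable stvol (slab i m) ('D_v phi).
Proof.
move=> mN dv c; apply: (test_derive_integrable oOmega T0 volfin tphi c dv).
  exact: slab_measurable.
exact: slab_sub.
Qed.

Lemma slab_integrand_integrable i m u : (1 <= m <= N)%N ->
  stvol.-integrable (slab i m)
    (fun p => (dot u (d_t phi p) + \sum_(k < d) dot (eflux k u) (d_x k phi p))%:E).
Proof.
move=> mN; have mS := slab_measurable i m.
apply: integrable_RD => //.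
  by apply: integrable_dotr => //; apply: slab_derive_integrable => //; left.
apply: integrable_Rsum => // k _.
have ix : vintegrable stvol (slab i m) (d_x k phi).
  by apply: slab_derive_integrable => //; right; exists k.
exact: (integrable_dotr (eflux k u) mS ix).
Qed.

(** The state u is constant, so the weighted divergence of phi integrates to the
    space-time flux of u through the faces. *)
Lemma cell_gauss_green i m u : (1 <= m <= N)%N ->
  \int[stvol]_(p in slab i m)
    (dot u (d_t phi p) + \sum_(k < d) dot (eflux k u) (d_x k phi p))
  = bdpair vol area G i m (fun s => nflux (stnormal G i s) u) phi.
Proof.
move=> mN; have [t0 tt tT] := tm_step htime mN.
have mS := slab_measurable i m.
have it : vintegrable stvol (slab i m) (d_t phi).
  by apply: slab_derive_integrable => //; left.
have ix k : vintegrable stvol (slab i m) (d_x k phi).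
  by apply: slab_derive_integrable => //; right; exists k.
rewrite RintegralD//; last 2 first.
- exact: integrable_dotr.
- by apply: integrable_Rsum => // k _; exact: (integrable_dotr (eflux k u) mS (ix k)).
rewrite (Rintegral_dotr _ mS it) Rintegral_sum//; last first.
  by move=> k _; exact: (integrable_dotr (eflux k u) mS (ix k)).
under eq_bigr do rewrite (Rintegral_dotr _ mS (ix _)).
rewrite (bdpairE hspace)//; last exact: test_trace_integrable.
rewrite /= !nflux_time scaleN1r scale1r dotNl -addrA addrC; congr (_ + _); last first.
  have vx k : vintegral stvol (slab i m) (d_x k phi) =
      \sum_(e | is_face G i e) onormal G i e 0 k *: lat_trace area G e m phi.
    apply/colP => c; rewrite mxE.
    rewrite (space_gauss_green oOmega T0 volfin tphi hspace i c t0 tT).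
    rewrite summxE; apply: eq_bigr => e ie; rewrite !mxE; congr (_ * _).
    by rewrite /Defs.Im Rintegral_open_time.
  under eq_bigr do rewrite vx dotC dot_suml.
  rewrite exchange_big; apply: eq_bigr => e ie.
  rewrite nflux_lat dot_suml; apply: eq_bigr => k _.
  by rewrite !dotZl dotC.
rewrite -dotBr; congr dot; apply/colP => c; rewrite !mxE.
exact: (time_gauss_green oOmega T0 volfin tphi c (mcell i)
  (cell_sub hspace (i:=i)) t0 tt tT).
Qed.

Lemma time_average_bounded m : (1 <= m <= N)%N -> exists M : R,
  forall x t c, closure Omega x -> `|Pi_time G m phi (x, t) c 0| <= M.
Proof.
move=> mN; have [M HM] := test_bounded tphi.
exists ((dtm G m)^-1 * (M * dtm G m)) => x t c Ox.
have d0 := dtm_gt0 htime mN.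
have cO s : Defs.Im G m s -> closure OT (x, s).
  by move=> /(Im_sub htime mN) sT; rewrite closure_OmegaT.
have lebI : (leb (Defs.Im G m) < +oo)%E by rewrite (Im_measure htime mN) ltry.
have mI : measurable (Defs.Im G m : set (measurableTypeR R)) by exact: measurable_itv.
have iphi : leb.-integrable (Defs.Im G m) (fun s => (phi (x, s) c 0)%:E).
  apply: measurable_bounded_integrable => //; last first.
    by apply: (@bounded_on _ _ _ _ _ M) => s /cO; exact: HM.
  apply: (@section_measurable1 _ _ _ _ _ _ (closure Omega) (Defs.Im G m)
     (fun p => phi p c 0)) => //.
    by apply: closed_measurable_rV; exact: closed_closure.
  apply: (test_measurable T0 tphi).
    apply: measurableX => //; apply: closed_measurable_rV; exact: closed_closure.
  by rewrite closure_OmegaT// => -[y s] [/= Oy /(Im_sub htime mN)].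
rewrite !mxE normrM ger0_norm ?invr_ge0 ?(ltW d0)// ler_wpM2l ?invr_ge0 ?(ltW d0)//.
apply: (le_trans (le_normr_Rintegral mI iphi)).
rewrite (_ : M * _ = \int[leb]_(s in Defs.Im G m) M); last first.
  rewrite Rintegral_cst//; congr (M * _).
  exact/esym/(congr1 fine (Im_measure htime mN)).
have : \int[leb]_(s in Defs.Im G m) `|phi (x, s) c 0| <=
       \int[leb]_(s in Defs.Im G m) M.
  apply: le_Rintegral => //.
  - exact: integrable_norm iphi.
  - apply: measurable_bounded_integrable => //; exact: bounded_cst.
  - by move=> s /cO; exact: HM.
exact.
Qed.

(** The measure is a parameter as the averages are integrated over cells by
    volume and over faces by area. *)
Lemma time_average_measurable (mu : {sigma_finite_measure set 'rV[R]_d -> \bar R})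
    (A : set 'rV[R]_d) m t c : (1 <= m <= N)%N -> measurable A ->
  (mu A < +oo)%E -> A `<=` closure Omega ->
  measurable_fun A (fun x => Pi_time G m phi (x, t) c 0).
Proof.
move=> mN mA Afin AO.
have mI : measurable (Defs.Im G m : set (measurableTypeR R)) by exact: measurable_itv.
have : mu.-integrable A (fun x => (\int[leb]_(s in Defs.Im G m) phi (x, s) c 0)%:E).
  apply: (@integrable_prodl _ _ _ _ _ mu leb A (Defs.Im G m) (fun p => phi p c 0)) => //.
  apply: (test_integrable T0 tphi).
  - exact: measurableX.
  - have : ((mu \x leb)%E (A `*` Defs.Im G m) < +oo)%E.
      rewrite product_measure1E//.
      apply: lte_mul_pinfty => //; first by rewrite ge0_fin_numE.
      have : (leb (Defs.Im G m) < +oo)%E by rewrite (Im_measure htime mN) ltry.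
      exact.
    exact.
  - by rewrite closure_OmegaT// => -[y s] [/= /AO Oy /(Im_sub htime mN)].
move=> /measurable_int/measurable_EFinP mF.
apply: (eq_measurable_fun (fun x => (dtm G m)^-1 *
    \int[leb]_(s in Defs.Im G m) phi (x, s) c 0)).
  by move=> x _; rewrite !mxE.
exact: measurable_funM.
Qed.

Lemma time_average_trace_integrable i m : (1 <= m <= N)%N ->
  trace_integrable_on vol area G i m (Pi_time G m phi).
Proof.
move=> mN; have [M HM] := time_average_bounded mN.
have cellE t : vintegrable vol (cell G i) (fun x => Pi_time G m phi (x, t)).
  move=> c; apply: measurable_bounded_integrable => //.
  - exact: cell_finite hspace i.
  - apply: (time_average_measurable (mu := vol)) => //.
      exact: cell_finite hspace i.
    by apply: subset_trans (closure_cell_sub hspace (i:=i)); exact: subset_closure.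
  apply: (@bounded_on _ _ _ _ _ M) => x ix; apply: HM.
  exact: (closure_cell_sub hspace (subset_closure ix)).
split => // e ie c.
have fO : face G e `<=` closure Omega.
  by move=> x ex; exact: (closure_cell_sub hspace (face_sub hspace ie ex)).
have mS := stface_measurable hspace e m.
apply: measurable_bounded_integrable => //.
- have : (starea (face G e `*` Defs.Im G m) < +oo)%E.
    by rewrite (stface_measure hspace htime)// ltry.
  exact.
- apply: (measurable_comp (F := face G e)
    (f := fun x => Pi_time G m phi (x, 0) c 0) (g := fst)) => //.
  + by move=> _ [[x t] [/= ex _] <-].
  + apply: (time_average_measurable (mu := area)) => //.
    exact: face_finite hspace e.
  + exact: measurable_funTS measurable_fst.
by apply: (@bounded_on _ _ _ _ _ M) => -[x t] [/= ex _]; apply: HM; exact: fO.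
Qed.

End test_on_grid.

(** * Consequences of Galerkin orthogonality *)

Section scheme_identities.
Context {R : realType} {d : nat} {I E : finType}.
Variables (vol area : {sigma_finite_measure set 'rV[R]_d -> \bar R}).
Variables (Omega : set 'rV[R]_d) (T : R) (G : grid R d I E).
Variables (theta : R) (Fr : (I -> nat -> state R d) -> I -> E -> nat -> state R d).
Variables (g phi : spacetime R d -> state R d) (Uc : I -> nat -> state R d).
Hypotheses (oOmega : open Omega) (T0 : 0 < T).
Hypotheses (hspace : is_space_grid vol area G Omega) (htime : is_time_grid G T).
Hypothesis hFr : riemann_flux G Fr.
Hypothesis hUc : fv_solution vol area G Fr theta g Uc.
Hypothesis tphi : test_space vol Omega T phi.
Local Notation ST := (spacetime R d).
Local Notation leb := (@lebesgue_measure R).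
Local Notation stvol := (vol \x leb)%E.
Local Notation N := (nsteps G).
Local Notation F := (stflux area G Fr theta g Uc).
Local Notation Fe := (face_flux area G Fr g Uc).
Local Notation Z := (lat_trace area G).
Local Notation Y := (level_trace vol G).

(** Constants have no derivatives, so orthogonality reduces to the boundary
    pairings. *)
Lemma galerkin_constants (w : I -> nat -> state R d) :
  \sum_i \sum_(1 <= m < N.+1) bdpair vol area G i m (F i m) (fun=> w i m) = 0.
Proof.
case: hUc => _ _ /(_ w) + _; rewrite /galerkin_form.
rewrite [X in _ - X = _ -> _]big1 ?subr0// => i _; rewrite big1// => m _.
have D0 v (c : state R d) p : 'D_v (fun _ : ST => c) p = 0 by exact: derive_cst.
rewrite [X in X + _](_ : _ = 0) ?add0r; last first.
  apply: Rintegral_eq0_ae; apply: aeW => p _.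
  by rewrite /d_t D0 dot0r.
apply: Rintegral_eq0_ae; apply: aeW => p _.
by rewrite big1// => k _; rewrite /d_x D0 dot0r.
Qed.

(** Orthogonality to the indicator functions of a single cell. *)
Lemma flux_balance i m : (1 <= m <= N)%N ->
  dtm G m *: (\sum_(e | is_face G i e) farea area G e *: Fe i e m)
  + cvol vol G i *: (time_flux theta Uc i m - time_flux theta Uc i m.-1) = 0.
Proof.
move=> mN; apply: dot_eq0 => v.
pose w j n := if (j == i) && (n == m) then v else 0.
have := galerkin_constants w; rewrite (bigD1 i)//= [X in _ + X]big1 ?addr0; last first.
  move=> j ji; rewrite big_nat_cond big1// => n; rewrite andbT => nN.
  by rewrite /w (negbTE ji)/= (bdpair_cst hspace htime)// dot0r.
rewrite (bigD1_seq m) ?mem_index_iota ?iota_uniq//= [X in _ + X]big_nat_cond.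
rewrite [X in _ + X]big1 ?addr0; last first.
  move=> n /andP[nN nm].
  by rewrite /w (negbTE nm) andbF (bdpair_cst hspace htime)// dot0r.
by rewrite /w !eqxx/= (bdpair_cst hspace htime).
Qed.

(** The scheme and [flux_balance] contain the same face fluxes; comparing them,
    the increment of the time flux over I_m is U_i^m - U_i^{m-1}.  Induction on
    m from the initial value gives the claim for every theta. *)
Lemma time_flux_eq i m : (m <= N)%N -> time_flux theta Uc i m = Uc i m.
Proof.
elim: m => [//|m IH] mN.
have m1N : (1 <= m.+1 <= N)%N by [].
have := flux_balance i m1N; rewrite -[_.+1.-1]/m IH ?(ltnW mN)//.
case: hUc => _ /(_ i m.+1 m1N) + _ _.
set S := \sum_(e | _) _ => sch bal.
have c0 : cvol vol G i != 0 by rewrite gt_eqF// (cvol_gt0 hspace).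
have {}sch : Uc i m = Uc i m.+1 + (dtm G m.+1 / cvol vol G i) *: S by rewrite sch.
move: bal; rewrite sch => {sch}.
move: (time_flux theta Uc i m.+1) (Uc i m.+1) S => X V S bal.
apply/colP => c; have /colP/(_ c) := bal; rewrite !mxE => bc.
apply: (mulfI c0); apply/eqP; rewrite -subr_eq0 -[X in _ == X]bc.
by apply/eqP; field.
Qed.

Lemma initial_value i : Uc i 0%N = initial_avg vol G g i.
Proof. by case: hUc. Qed.

(** The two differences of phi telescope to phi minus its average over the cell.
    The average is constant on the cell and drops out: from the numerical fluxes
    by orthogonality, from f_nu(U_h^+) by [bdpair_nflux_cst]. *)
Lemma eta_sum :
  eta_k vol area G Fr theta g Uc phi + eta_h vol area G Fr theta g Uc phi =
  \sum_i \sum_(1 <= m < N.+1) bdpair vol area G i m (F i m) phi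
  - \sum_i \sum_(1 <= m < N.+1) \int[stvol]_(p in slab G i m)
      (dot (Uc i m) (d_t phi p)
       + \sum_(k < d) dot (eflux k (Uc i m)) (d_x k phi p)).
Proof.
(* The average is the same at all points of the cell; (0, 0) is arbitrary. *)
pose W i m := Pi_space vol G i (Pi_time G m phi) (0, 0).
have G0 := galerkin_constants W.
rewrite /eta_k /eta_h -!sumrB -[RHS]subr0 -[X in _ = _ - X]G0.
rewrite -big_split -sumrB; apply: eq_bigr => i _ /=.
rewrite -big_split -!sumrB; apply: eq_big_nat => m; rewrite ltnS => mN.
rewrite (cell_gauss_green oOmega T0 hspace htime tphi)//.
have i1 := test_trace_integrable oOmega T0 hspace htime tphi i mN.
have i2 := time_average_trace_integrable T0 hspace htime tphi i mN.
have i3 := cst_trace_integrable hspace htime i (W i m) mN.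
rewrite (bdpairBr hspace _ i1 i2).
rewrite (bdpairBr hspace (w2 := fun=> W i m) _ i2 i3).
rewrite !(bdpairBl hspace)// (bdpair_nflux_cst hspace htime)//=.
by rewrite subr0 addrA subrK.
Qed.

(** An interior face belongs to two cells, whose fluxes are opposite. *)
Lemma lateral_flux_sum m :
  \sum_i \sum_(e | is_face G i e) dot (Fe i e m) (Z e m phi) =
  \sum_(e | is_bface G e) dot (Fe (lcell G e) e m) (Z e m phi).
Proof.
rewrite (exchange_big_dep xpredT)//= [RHS]big_mkcond; apply: eq_bigr => e _.
rewrite (bigD1 (lcell G e)); last by rewrite /is_face eqxx.
rewrite /=; case: ifPn => [be|].
  rewrite big1 ?addr0// => i /andP[]; rewrite /is_face (eqP be) orbF => /eqP ->.
  by rewrite eqxx.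
rewrite {1}/is_bface; case re : (rcell G e) => [j|]// _.
have jl : lcell G e != j.
  case: hspace => _ _ [_ /(_ e) + _ _] _; rewrite re.
  by apply: contra_neq => ->.
rewrite (bigD1 j)/=; last by rewrite /is_face re eqxx orbT/= eq_sym.
rewrite big1 ?addr0; last first.
  move=> i /andP[/andP[+ il] ij].
  by rewrite /is_face re eq_sym (negbTE il)/= => /eqP[ji]; rewrite ji eqxx in ij.
case: hFr => /(_ Uc e j m re) cons _.
by rewrite /face_flux /is_bface re/= cons dotNl addNr.
Qed.

Lemma flux_sum :
  \sum_i \sum_(1 <= m < N.+1) bdpair vol area G i m (F i m) phi =
  \sum_(e | is_bface G e) \sum_(1 <= m < N.+1)
     dot (Fe (lcell G e) e m) (Z e m phi)
  + \sum_i (dot (Uc i N) (Y i N phi) - dot (Uc i 0%N) (Y i 0%N phi)).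
Proof.
transitivity (\sum_i (\sum_(1 <= m < N.+1)
     \sum_(e | is_face G i e) dot (Fe i e m) (Z e m phi)
   + (dot (Uc i N) (Y i N phi) - dot (Uc i 0%N) (Y i 0%N phi)))).
  apply: eq_bigr => i _.
  (* The index is written m.-1.+1 to match the telescoping of the shifted sum. *)
  rewrite (eq_big_nat _ _ (F2 := fun m =>
      \sum_(e | is_face G i e) dot (Fe i e m) (Z e m phi)
      + (dot (Uc i m.-1.+1) (Y i m.-1.+1 phi) - dot (Uc i m.-1) (Y i m.-1 phi)))).
    rewrite big_split/=; congr (_ + _).
    rewrite big_add1/= telescope_sumr//.
  move=> m; rewrite ltnS => mN.
  rewrite (bdpairE hspace); last first.
    exact: (test_trace_integrable oOmega T0 hspace htime tphi i mN).
  have /andP[m1 mN'] := mN.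
  rewrite /= dotNl !time_flux_eq// ?(leq_trans (leq_pred _))//.
  by rewrite prednK// -addrA.
rewrite big_split/= exchange_big/=; congr (_ + _).
rewrite [RHS]exchange_big/=; apply: eq_bigr => m _.
exact: lateral_flux_sum.
Qed.

End scheme_identities.

(** * The discrete solution almost everywhere *)

Section pieces.
Context dd (S : measurableType dd) (R : realType).
Variable mu : {measure set S -> \bar R}.
Variables (J : finType) (P : pred J) (B : J -> set S) (h : J -> S -> R).
Variable D : set S.
Hypotheses (mD : measurable D) (mB : forall j, P j -> measurable (B j)).
Hypothesis BD : forall j, P j -> B j `<=` D.
Hypothesis inth : forall j, P j -> mu.-integrable (B j) (EFin \o h j).

(** A function that is prescribed piecewise up to a null set is compared with
    this one, which is integrable by construction.  On overlaps of pieces it is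
    the sum of the prescribed values; below, pieces overlap in null sets only. *)
Definition glue x := \sum_(j | P j) (h j \_ (B j)) x.

Let patch_integrable j : P j -> mu.-integrable D (EFin \o (h j \_ (B j))).
Proof.
move=> Pj; rewrite -restrict_EFin; apply/integrable_restrict => //.
  exact: mB.
by rewrite setIidr; [exact: inth|exact: BD].
Qed.

Lemma glue_integrable : mu.-integrable D (EFin \o glue).
Proof. by apply: integrable_Rsum => // j Pj; exact: patch_integrable. Qed.

Lemma Rintegral_glue :
  \int[mu]_(x in D) glue x = \sum_(j | P j) \int[mu]_(x in B j) h j x.
Proof.
rewrite Rintegral_sum//; apply: eq_bigr => j Pj.
by rewrite -Rintegral_mkcondr setIidr//; exact: BD.
Qed.

Lemma glueE j x : P j -> B j x -> (forall k, P k -> B k x -> k = j) ->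
  glue x = h j x.
Proof.
move=> Pj Bx uj; rewrite /glue (bigD1 j)//= patchE mem_set// big1 ?addr0//.
move=> k /andP[Pk kj]; rewrite patchE memNset// => Bk.
by rewrite (uj k Pk Bk) eqxx in kj.
Qed.

End pieces.

Section discrete_solution.
Context {R : realType} {d : nat} {I E : finType}.
Variables (vol area : {sigma_finite_measure set 'rV[R]_d -> \bar R}).
Variables (Omega : set 'rV[R]_d) (T : R) (G : grid R d I E).
Variable (Uc : I -> nat -> state R d).
Hypotheses (oOmega : open Omega) (T0 : 0 < T).
Hypotheses (hspace : is_space_grid vol area G Omega) (htime : is_time_grid G T).
Local Notation leb := (@lebesgue_measure R).
Local Notation N := (nsteps G).
Local Notation Uh := (cellwise G Uc).

Lemma cells_disjoint i j x : cell G i x -> cell G j x -> i = j.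
Proof.
move=> ix jx; apply/eqP; apply: contrapT => /negP ij.
case: hspace => -[_ _ _ /(_ i j ij) + _] _ _ _.
by move=> /seteqP[/(_ x) + _]; apply.
Qed.

Lemma bface_sub e : is_bface G e -> face G e `<=` closure Omega `\` Omega.
Proof. by move=> be; case: hspace => _ _ [_ _ /(_ e be)]. Qed.

Lemma cell_ofE i x : cell G i x -> cell_of G x = Some i.
Proof.
move=> ix; rewrite /cell_of; case: pickP => [j|/(_ i)]; last first.
  by move=> /asboolPn; case; left.
move=> /asboolP[jx|[e [be _ ex]]]; first by rewrite (cells_disjoint ix jx).
by have [_] := bface_sub be ex; case; exact: (cell_sub hspace ix).
Qed.

(** On the intersection of several boundary faces [cell_of] and [bnormal] make
    an arbitrary choice; the uniqueness hypothesis avoids that null set. *)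
Lemma cell_of_bface e x : is_bface G e -> face G e x ->
  (forall e', is_bface G e' -> face G e' x -> e' = e) ->
  cell_of G x = Some (lcell G e).
Proof.
move=> be ex ue; rewrite /cell_of; case: pickP => [j|/(_ (lcell G e))]; last first.
  by move=> /asboolPn; case; right; exists e.
move=> /asboolP[jx|[e' [be' <- ex']]]; last by rewrite (ue e').
by have [_] := bface_sub be ex; case; exact: (cell_sub hspace jx).
Qed.

Lemma bnormal_bface e x : is_bface G e -> face G e x ->
  (forall e', is_bface G e' -> face G e' x -> e' = e) ->
  bnormal G x = fnormal G e.
Proof.
move=> be ex ue; rewrite /bnormal; case: pickP => [e'|/(_ e)].
  by move=> /andP[be' /asboolP ex']; rewrite (ue e').
by rewrite be/= => /asboolPn.
Qed.

Lemma level_ofE m t : (1 <= m <= N)%N -> tm G m.-1 < t <= tm G m ->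
  level_of G t = m.
Proof.
move=> /andP[m1 mN] /andP[t1 t2]; rewrite /level_of.
set a := fun k => t <= tm G k.+1.
have mpN : (m.-1 < N)%N by rewrite prednK.
have ha : has a (iota 0 N).
  by apply/hasP; exists m.-1; rewrite ?mem_iota//= /a prednK.
have fN : (find a (iota 0 N) < N)%N by rewrite -[X in (_ < X)%N](size_iota 0) -has_find.
have := nth_find 0%N ha; rewrite nth_iota// add0n /a => tf.
rewrite -[RHS](prednK m1); congr S; apply/eqP; rewrite eqn_leq; apply/andP; split.
  rewrite leqNgt; apply/negP => /(before_find 0%N).
  by rewrite nth_iota// add0n /a prednK// t2.
rewrite leqNgt; apply/negP => fm.
have : tm G (find a (iota 0 N)).+1 <= tm G m.-1.
  by apply: (tm_le htime); rewrite fm (leq_trans (leq_pred _)).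
by move=> /(le_trans tf); rewrite leNgt t1.
Qed.

Lemma time_slot t : 0 < t <= T ->
  exists2 m, (1 <= m <= N)%N & tm G m.-1 < t <= tm G m.
Proof.
move=> /andP[t0 tT]; case: (htime) => N0 tm0 tmN _.
have ex : exists m, (m <= N)%N && (t <= tm G m) by exists N; rewrite leqnn tmN.
case: (ex_minnP ex) => m /andP[mN tm_] mmin; exists m.
  rewrite mN andbT lt0n; apply/eqP => m0.
  by move: tm_; rewrite m0 tm0 leNgt t0.
rewrite tm_ andbT ltNge; apply/negP => tm1.
have m0 : (0 < m)%N.
  by rewrite lt0n; apply/eqP => m0; move: tm_; rewrite m0 tm0 leNgt t0.
have := mmin m.-1; rewrite tm1 (leq_trans (leq_pred _))// => /(_ isT).
by rewrite leqNgt prednK ?leqnn.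
Qed.

Lemma cellwise_cell i m x t : (1 <= m <= N)%N -> cell G i x ->
  tm G m.-1 < t <= tm G m -> Uh (x, t) = Uc i m.
Proof. by move=> mN ix tt; rewrite /cellwise /= (cell_ofE ix) (level_ofE mN tt). Qed.

Lemma vol_ae_cell : {ae vol, forall x, Omega x -> exists i, cell G i x}.
Proof.
have [K [mK K0 fK]] := null_face_union hspace.
exists K; split => // x /= nx; apply: fK.
move: nx => /not_implyP[Ox nx].
by have [//|[e ex]] := closure_Omega_cover hspace (subset_closure Ox); exists e.
Qed.

Lemma area_ae_bface : {ae area, forall x, (closure Omega `\` Omega) x ->
  exists e, [/\ is_bface G e, face G e x
    & forall e', is_bface G e' -> face G e' x -> e' = e]}.
Proof.
have mf e : measurable (face G e) := face_measurable hspace e.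
pose K1 := (closure Omega `\` Omega) `\`
  \bigcup_(e in [set e | is_bface G e]) face G e.
have nK1 : area.-negligible K1.
  have mK : measurable K1.
    apply: measurableD; last first.
      by apply: fin_bigcup_measurable => //; exact: finite_finset.
    apply: measurableD; last exact: open_measurable_rV.
    by apply: closed_measurable_rV; exact: closed_closure.
  by apply/negligibleP => //; case: hspace => _ _ [_ _ _ cov] _; exact: cov.
pose ov (p : E * E) := if p.1 == p.2 then set0 else face G p.1 `&` face G p.2.
have nov : area.-negligible (\big[setU/set0]_(p : E * E) ov p).
  elim/big_ind : _ => [|X Y|p _]; first exact: negligible_set0.
    exact: negligibleU.
  rewrite /ov; case: ifPn => [_|pp]; first exact: negligible_set0.
  apply/negligibleP; first exact: measurableI.
  case: hspace => _ [_ _ _ _ /(_ p.1 p.2 pp) pe] _ _; exact: pe.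
have [K [mK K0 sK]] := negligibleU nK1 nov.
exists K; split => // x /= nx; apply: sK; move: nx => /not_implyP[bx nx].
have [[e be ex]|nex] := pselect ((\bigcup_(e in [set e | is_bface G e]) face G e) x).
  right; rewrite -bigcup_seq.
  have [e' [be' ex' ee']] : exists e', [/\ is_bface G e', face G e' x & e' != e].
    apply: contrapT => ne; apply: nx; exists e; split => // e' be' ex'.
    by apply/eqP; apply: contrapT => /negP ee'; apply: ne; exists e'.
  exists (e', e) => /=; first exact: mem_index_enum.
  by rewrite /ov/= (negbTE ee').
by left.
Qed.

Lemma leb_ae_slot : {ae leb, forall t, t \in `]0, T[ ->
  exists2 m, (1 <= m <= N)%N & tm G m.-1 < t < tm G m}.
Proof.
pose K : set R := [set tm G m | m in `I_N.+1].
have cK : countable K.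
  by apply: finite_set_countable; apply: finite_image; exact: finite_II.
exists K; split.
- exact: countable_measurable.
- exact: countable_lebesgue_measure0.
move=> t /= /not_implyP[+ nt]; rewrite in_itv/= => /andP[t0 tT].
have [m mN /andP[t1 t2]] : exists2 m, (1 <= m <= N)%N & tm G m.-1 < t <= tm G m.
  by apply: time_slot; rewrite t0 ltW.
exists m; first by move: mN => /andP[_]; rewrite /= ltnS.
apply/eqP; rewrite eq_le t2 andbT leNgt; apply/negP => t3.
by apply: nt; exists m => //; rewrite t1.
Qed.

Lemma ae_prod (m : {sigma_finite_measure set 'rV[R]_d -> \bar R})
    (P : 'rV[R]_d -> Prop) (Q : R -> Prop) :
  {ae m, forall x, P x} -> {ae leb, forall t, Q t} ->
  {ae (m \x leb)%E, forall p, P p.1 /\ Q p.2}.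
Proof.
move=> [A [mA A0 sA]] [B [mB B0 sB]].
exists ((A `*` setT) `|` (setT `*` B)); split.
- by apply: measurableU; exact: measurableX.
- have mA' : measurable (A `*` [set: measurableTypeR R]) by exact: measurableX.
  have mB' : measurable ([set: 'rV[R]_d] `*` (B : set (measurableTypeR R))).
    exact: measurableX.
  have eA : ((m \x leb)%E (A `*` setT) = 0)%E.
    by rewrite product_measure1E// [X in (X * _)%E]A0 mul0e.
  have eB : ((m \x leb)%E (setT `*` B) = 0)%E.
    by rewrite product_measure1E// [X in (_ * X)%E]B0 mule0.
  by rewrite null_set_setU.
move=> [x t] /= /not_andP[Px|Qt].
  by left; split => //=; exact: sA.
by right; split => //=; exact: sB.
Qed.

End discrete_solution.

(** * The volume terms *)

Section error_identity.
Context {R : realType} {d : nat} {I E : finType}.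
Variables (vol area : {sigma_finite_measure set 'rV[R]_d -> \bar R}).
Variables (Omega : set 'rV[R]_d) (T : R) (G : grid R d I E).
Variables (g psi psiG phi U Ut : spacetime R d -> state R d).
Variable (Uc : I -> nat -> state R d).
Hypotheses (oOmega : open Omega) (T0 : 0 < T).
Hypotheses (hspace : is_space_grid vol area G Omega) (htime : is_time_grid G T).
Hypothesis tphi : test_space vol Omega T phi.
Local Notation ST := (spacetime R d).
Local Notation leb := (@lebesgue_measure R).
Local Notation stvol := (vol \x leb)%E.
Local Notation OT := (OmegaT Omega T : set (_ * measurableTypeR R)).
Local Notation N := (nsteps G).
Local Notation Uh := (cellwise G Uc).

Definition flux_pairing (u : state R d) (p : ST) : R :=
  dot u (d_t phi p) + \sum_(k < d) dot (eflux k u) (d_x k phi p).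

Definition discrete_pairing : ST -> R :=
  glue xpredT (fun j : I * 'I_N => slab G j.1 j.2.+1)
    (fun j => flux_pairing (Uc j.1 j.2.+1)).

Let slab_index (j : I * 'I_N) : (1 <= j.2.+1 <= N)%N.
Proof. exact: ltn_ord. Qed.

Lemma discrete_pairing_integrable :
  stvol.-integrable OT (EFin \o discrete_pairing).
Proof.
apply: glue_integrable.
- exact: measurable_OmegaT.
- by move=> j _; exact: slab_measurable hspace j.1 j.2.+1.
- by move=> j _; apply: (slab_sub hspace htime); exact: slab_index.
- move=> j _; exact: (slab_integrand_integrable oOmega T0 hspace htime tphi
    j.1 (Uc j.1 j.2.+1) (slab_index j)).
Qed.

Lemma Rintegral_discrete_pairing :
  \int[stvol]_(p in OT) discrete_pairing p =
  \sum_i \sum_(1 <= m < N.+1) \int[stvol]_(p in slab G i m) flux_pairing (Uc i m) p.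
Proof.
rewrite Rintegral_glue; first last.
- move=> j _; exact: (slab_integrand_integrable oOmega T0 hspace htime tphi
    j.1 (Uc j.1 j.2.+1) (slab_index j)).
- by move=> j _; apply: (slab_sub hspace htime); exact: slab_index.
- by move=> j _; exact: slab_measurable hspace j.1 j.2.+1.
- exact: measurable_OmegaT.
rewrite -(pair_bigA _ (fun i (k : 'I_N) =>
  \int[stvol]_(p in slab G i k.+1) flux_pairing (Uc i k.+1) p)) /=.
by apply: eq_bigr => i _; rewrite big_add1/= big_mkord.
Qed.

Lemma discrete_pairing_ae : {ae stvol, forall p, OT p ->
  discrete_pairing p = flux_pairing (Uh p) p}.
Proof.
have := ae_prod (vol_ae_cell hspace) (leb_ae_slot htime).
apply: ae_imp => -[x t] /= [cx ct] [/= Ox tT].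
have [i ix] := cx Ox; have [m mN /andP[t1 t2]] := ct tT.
have tm_ : tm G m.-1 < t <= tm G m by rewrite t1 ltW.
rewrite (cellwise_cell Uc hspace htime mN ix tm_).
have /andP[m1 mN'] := mN.
have mp : (m.-1 < N)%N by rewrite prednK.
transitivity (flux_pairing (Uc i m.-1.+1) (x, t)); last by rewrite prednK.
apply: (@glueE _ _ _ _ _ _ _ (i, Ordinal mp)) => //.
  by rewrite /slab/= prednK//; split => //=; rewrite in_itv/= t1.
move=> [j k] _ [/= jx]; rewrite in_itv/= => /andP[k1 k2].
rewrite (cells_disjoint hspace jx ix); congr (_, _); apply: val_inj => /=.
have kN : (1 <= k.+1 <= N)%N by exact: ltn_ord.
have := level_ofE htime kN (t := t); rewrite k1 (ltW k2) => /(_ isT).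
by rewrite (level_ofE htime mN tm_) => ->.
Qed.

Lemma dot_derive_integrable (V : ST -> state R d) v : coordinate_direction v ->
  vintegrable stvol OT V ->
  stvol.-integrable OT (fun p => (dot (V p) ('D_v phi p))%:E).
Proof.
move=> dv iV; have [M HM] := test_derive_bounded oOmega tphi v.
apply: (@integrable_dot_bounded _ _ _ _ _ OT V ('D_v phi) M) => //.
  exact: measurable_OmegaT.
move=> c; apply: (test_derive_measurable oOmega tphi) => //.
exact: measurable_OmegaT.
Qed.

(** Almost everywhere the integrand of eps_Omega is the flux pairing of U minus
    that of U_h minus the integrand of J(U) - J(U_h).  These three are
    integrable, and so the integral of eps_Omega can be split without any
    knowledge about the matrices Df(U_h) as functions of the point. *)
Lemma volume_terms :
  vintegrable stvol OT U ->
  (forall k, vintegrable stvol OT (fun p => eflux k (U p))) ->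
  {ae stvol, forall p, OT p ->
     d_t phi p + \sum_(k < d) (Atilde (Uh p) k)^T *m d_x k phi p = psi p} ->
  stvol.-integrable OT (fun p => (dot (U p) (psi p))%:E) ->
  stvol.-integrable OT (fun p => (dot (Uh p) (psi p))%:E) ->
  OmegaT_pair vol Omega T U psi - OmegaT_pair vol Omega T Uh psi
  + \int[stvol]_(p in OT) (\sum_(k < d) dot (eflux k (U p) - eflux k (Uh p)
                       - Atilde (Uh p) k *m (U p - Uh p)) (d_x k phi p))
  = OmegaT_pair vol Omega T U (d_t phi)
    + \int[stvol]_(p in OT) (\sum_(k < d) dot (eflux k (U p)) (d_x k phi p))
  - \sum_i \sum_(1 <= m < N.+1)
      \int[stvol]_(p in slab G i m) flux_pairing (Uc i m) p.
Proof.
move=> iU ifU adj iUp iHp.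
have mOT : measurable (OT : set (_ * measurableTypeR R)) by exact: measurable_OmegaT.
have it : stvol.-integrable OT (fun p => (dot (U p) (d_t phi p))%:E).
  by apply: dot_derive_integrable => //; left.
have ix : stvol.-integrable OT
    (fun p => (\sum_(k < d) dot (eflux k (U p)) (d_x k phi p))%:E).
  apply: (integrable_Rsum _ mOT) => k _.
  have dk : coordinate_direction (dir_x k : ST) by right; exists k.
  exact: (dot_derive_integrable dk (ifU k)).
have ic : stvol.-integrable OT (fun p => (flux_pairing (U p) p)%:E).
  exact: (integrable_RD mOT it ix).
have id := discrete_pairing_integrable.
have ia : stvol.-integrable OT (fun p => (dot (U p) (psi p) - dot (Uh p) (psi p))%:E).
  exact: (integrable_RB mOT iUp iHp).
have icd : stvol.-integrable OT
    (fun p => (flux_pairing (U p) p - discrete_pairing p)%:E).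
  exact: (integrable_RB mOT ic id).
rewrite /OmegaT_pair -(RintegralB mOT iUp iHp) -(RintegralD mOT it ix).
rewrite -Rintegral_discrete_pairing -(RintegralB mOT ic id).
rewrite [X in _ + X](_ : _ = \int[stvol]_(p in OT)
   (flux_pairing (U p) p - discrete_pairing p
    - (dot (U p) (psi p) - dot (Uh p) (psi p)))).
  by rewrite (RintegralB mOT icd ia) addrC subrK.
apply: ae_eq_Rintegral; have := ae_and adj discrete_pairing_ae.
apply: ae_imp => p [adjp disp] Op; rewrite (disp Op) -(adjp Op) /flux_pairing.
rewrite !dotDr !(dotC _ (\sum_(k < d) _)) !dot_suml.
rewrite (eq_bigr (fun k => dot (eflux k (U p)) (d_x k phi p)
   - dot (eflux k (Uh p)) (d_x k phi p)
   - (dot ((Atilde (Uh p) k)^T *m d_x k phi p) (U p)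
      - dot ((Atilde (Uh p) k)^T *m d_x k phi p) (Uh p)))); last first.
  by move=> k _; rewrite !dotBl dot_mulmx dotBl !(dotC (_ *m _)).
by rewrite !sumrB; ring.
Qed.

End error_identity.

(** * The boundary terms *)

Section boundary_identity.
Context {R : realType} {d : nat} {I E : finType}.
Variables (vol area : {sigma_finite_measure set 'rV[R]_d -> \bar R}).
Variables (Omega : set 'rV[R]_d) (T : R) (G : grid R d I E).
Hypotheses (oOmega : open Omega) (T0 : 0 < T).
Hypotheses (hspace : is_space_grid vol area G Omega) (htime : is_time_grid G T).
Local Notation ST := (spacetime R d).
Local Notation leb := (@lebesgue_measure R).
Local Notation starea := (area \x leb)%E.
Local Notation OT := (OmegaT Omega T).
Local Notation lat := (lateral Omega T : set (_ * measurableTypeR R)).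
Local Notation N := (nsteps G).

Let volfin : (vol Omega < +oo)%E := Omega_finite oOmega hspace.
Let mOmega : measurable Omega := open_measurable_rV oOmega.
Let mface e : measurable (face G e) := face_measurable hspace e.
Let mcell i : measurable (cell G i) := cell_measurable hspace i.

Lemma lateral_measurable : measurable lat.
Proof.
apply: measurableX; last exact: measurable_itv.
apply: measurableD => //; apply: closed_measurable_rV; exact: closed_closure.
Qed.

(** [GammaT_pair a b] is this functional at the function [dot a b], which makes
    linearity in the pairing available for combinations of several pairs. *)
Definition boundary_integral (h : ST -> R) : R :=
  \int[starea]_(p in lateral Omega T) h p
  + \int[vol]_(x in Omega) h (x, 0) + \int[vol]_(x in Omega) h (x, T).

Local Notation GI := boundary_integral.
Local Notation Gint := (GammaT_integrable vol area Omega T).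
Local Notation Gvint := (GammaT_vintegrable vol area Omega T).

Lemma GammaT_integrableB h k : Gint h -> Gint k -> Gint (fun p => h p - k p).
Proof.
move=> [h1 h2 h3] [k1 k2 k3]; split.
- exact: (integrable_RB lateral_measurable h1 k1).
- exact: (integrable_RB mOmega h2 k2).
- exact: (integrable_RB mOmega h3 k3).
Qed.

Lemma boundary_integralD h k : Gint h -> Gint k ->
  GI (fun p => h p + k p) = GI h + GI k.
Proof.
move=> [h1 h2 h3] [k1 k2 k3]; rewrite /GI (RintegralD lateral_measurable h1 k1).
by rewrite (RintegralD mOmega h2 k2) (RintegralD mOmega h3 k3); ring.
Qed.

Lemma boundary_integralB h k : Gint h -> Gint k ->
  GI (fun p => h p - k p) = GI h - GI k.
Proof.
move=> [h1 h2 h3] [k1 k2 k3]; rewrite /GI (RintegralB lateral_measurable h1 k1).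
by rewrite (RintegralB mOmega h2 k2) (RintegralB mOmega h3 k3); ring.
Qed.

Lemma eq_boundary_integral h k : h =1 k -> GI h = GI k.
Proof. by move=> hk; congr GI; exact/funext. Qed.

Section test_pairing.
Variable phi : spacetime R d -> state R d.
Hypothesis tphi : test_space vol Omega T phi.

Lemma GammaT_dot_integrable a : Gvint a -> Gint (fun p => dot (a p) (phi p)).
Proof.
move=> ia; have [M HM] := test_bounded tphi.
have latO : lat `<=` closure OT.
  rewrite closure_OmegaT// => -[x t] [[/= Ox _] tT]; split => //.
  exact: subset_itv_oo_cc tT.
have OmegaO t x : t \in `[0, T] -> Omega x -> closure OT (x, t).
  by move=> tT Ox; rewrite closure_OmegaT//; split => //; exact: subset_closure.
have tr t : t \in `[0, T] -> vintegrable vol Omega (fun x => a (x, t)) ->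
    vol.-integrable Omega (fun x => (dot (a (x, t)) (phi (x, t)))%:E).
  move=> tT it; apply: (integrable_dot_bounded (M := M) mOmega it) => [c|x c Ox].
    have /measurable_int/measurable_EFinP :=
      trace_integrable oOmega T0 volfin tphi c mOmega (@subset_refl _ Omega) tT.
    exact.
  by apply: HM; exact: OmegaO.
split.
- have il : vintegrable starea lat a by move=> c; case: (ia c).
  apply: (integrable_dot_bounded (M := M) lateral_measurable il) => [c|p c lp].
    exact: (test_measurable T0 tphi c lateral_measurable latO).
  by apply: HM; exact: latO.
- apply: tr; first by rewrite in_itv/= lexx ltW.
  by move=> c; case: (ia c).
- apply: tr; first by rewrite in_itv/= lexx andbT ltW.
  by move=> c; case: (ia c).
Qed.

End test_pairing.

Lemma Rintegral_cells (f : 'rV[R]_d -> R) (h : I -> 'rV[R]_d -> R) :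
  (forall i, vol.-integrable (cell G i) (EFin \o h i)) ->
  (forall i x, cell G i x -> f x = h i x) ->
  \int[vol]_(x in Omega) f x = \sum_i \int[vol]_(x in cell G i) h i x.
Proof.
move=> ih fh; rewrite -(Rintegral_glue (P := xpredT) mOmega) => //; last first.
  by move=> i _; exact: cell_sub hspace i.
apply: ae_eq_Rintegral; apply: ae_imp (vol_ae_cell hspace) => x cx Ox.
have [i ix] := cx Ox; rewrite (fh i x ix); apply/esym.
by apply: glueE => // j _ jx; exact: (cells_disjoint hspace jx ix).
Qed.

Definition face_slab e m : set (_ * measurableTypeR R) :=
  face G e `*` `]tm G m.-1, tm G m[.

Lemma face_slab_measurable e m : measurable (face_slab e m).
Proof. by apply: measurableX. Qed.

Lemma face_slab_sub e m : is_bface G e -> (1 <= m <= N)%N ->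
  face_slab e m `<=` lat.
Proof.
move=> be mN [x t] [/= ex tt]; have [t0 _ tT] := tm_step htime mN.
split => /=; first exact: (bface_sub hspace be ex).
move: tt; rewrite !in_itv/= => /andP[h1 h2].
by rewrite (le_lt_trans t0 h1) (lt_le_trans h2 tT).
Qed.

Lemma Rintegral_lateral (f : ST -> R) (h : E -> nat -> ST -> R) :
  (forall e m, is_bface G e -> (1 <= m <= N)%N ->
     starea.-integrable (face_slab e m) (EFin \o h e m)) ->
  (forall e m x t, is_bface G e -> (1 <= m <= N)%N -> face G e x ->
     (forall e', is_bface G e' -> face G e' x -> e' = e) ->
     tm G m.-1 < t < tm G m -> f (x, t) = h e m (x, t)) ->
  \int[starea]_(p in lateral Omega T) f p
  = \sum_(e | is_bface G e) \sum_(1 <= m < N.+1)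
      \int[starea]_(p in face_slab e m) h e m p.
Proof.
move=> ih fh.
pose B (j : E * 'I_N) := face_slab j.1 j.2.+1.
pose k (j : E * 'I_N) := h j.1 j.2.+1.
have nN (j : 'I_N) : (1 <= j.+1 <= N)%N by exact: ltn_ord.
transitivity (\sum_(j : E * 'I_N | is_bface G j.1) \int[starea]_(p in B j) k j p);
    last first.
  rewrite [RHS](eq_bigr (fun e => \sum_(n < N)
    \int[starea]_(p in face_slab e n.+1) h e n.+1 p)); last first.
    by move=> e be; rewrite big_add1/= big_mkord.
  by rewrite pair_big; apply: eq_bigl => j; rewrite andbT.
rewrite -(Rintegral_glue lateral_measurable); last 3 first.
- by move=> j _; exact: face_slab_measurable.
- by move=> j be; exact: face_slab_sub.
- by move=> j be; exact: ih.
apply: ae_eq_Rintegral.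
have := ae_prod (area_ae_bface oOmega hspace) (leb_ae_slot htime).
apply: ae_imp => -[x t] /= [cx ct] [/= bx tT].
have [e [be ex ue]] := cx bx; have [m mN /andP[t1 t2]] := ct tT.
rewrite (fh e m x t)// ?t1//.
have /andP[m1 mN'] := mN; have mp : (m.-1 < N)%N by rewrite prednK.
transitivity (h e m.-1.+1 (x, t)); first by rewrite prednK.
apply/esym; apply: (@glueE _ _ _ _ _ _ _ (e, Ordinal mp)) => //.
  by rewrite /B /face_slab/= prednK//; split => //=; rewrite in_itv/= t1.
move=> [e' n] be' [/= ex']; rewrite in_itv/= => /andP[k1 k2].
congr (_, _); first exact: ue.
apply: val_inj => /=.
have := level_ofE htime (nN n) (t := t); rewrite k1 (ltW k2) => /(_ isT).
by rewrite (level_ofE htime mN (t := t)) ?t1 ?(ltW t2)// => ->.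
Qed.

Section discrete_boundary.
Variables (g phi : spacetime R d -> state R d) (Uc : I -> nat -> state R d).
Hypothesis tphi : test_space vol Omega T phi.
Hypothesis ig : Gvint g.
Local Notation Uh := (cellwise G Uc).
Local Notation boundary_pairing := (fun p =>
  dot (outflow G T Uh p) (phi p) + dot (inflow G T Uh g p) (phi p)).
Local Notation Z := (lat_trace area G).
Local Notation Y := (level_trace vol G).

Let level_phi i t : t \in `[0, T] -> vintegrable vol (cell G i) (fun x => phi (x, t)).
Proof.
move=> tT c; apply: (trace_integrable oOmega T0 volfin tphi c (mcell i)) => //.
exact: cell_sub hspace i.
Qed.

(** The normal is (0, -1): nothing flows out, and the inflow is all of g.  The
    initial value of the scheme is the average of -g, whence the signs. *)
Lemma initial_boundary_integral :
  \int[vol]_(x in Omega) boundary_pairing (x, 0) =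
  \sum_i (\int[vol]_(x in cell G i)
             dot (g (x, 0) + initial_avg vol G g i) (phi (x, 0))
           - dot (initial_avg vol G g i) (Y i 0%N phi)).
Proof.
have z0 : 0 \in `[0, T] by rewrite in_itv/= lexx ltW.
have tm0 : tm G 0 = 0 by case: htime.
have igc i : vol.-integrable (cell G i) (fun x => (dot (g (x, 0)) (phi (x, 0)))%:E).
  have [_ ig0 _] := GammaT_dot_integrable tphi ig.
  by apply: (integrableS mOmega) ig0; [exact: mcell|exact: cell_sub hspace i].
rewrite (Rintegral_cells (h := fun i x => dot (g (x, 0)) (phi (x, 0)))) //.
  apply: eq_bigr => i _; under [in RHS]eq_Rintegral do rewrite dotDl.
  rewrite (RintegralD (mcell i)) //; last first.
    exact: (integrable_dotr _ (mcell i) (level_phi i z0)).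
  by rewrite (Rintegral_dotr _ (mcell i) (level_phi i z0)) /level_trace tm0 addrK.
move=> i x _; rewrite /outflow /inflow /nu/= lt_eqF// eqxx.
by rewrite Pplus_initial Pminus_initial mul0mx mul1mx dot0l add0r.
Qed.

(** The normal is (0, 1): the flux is the outflow of U_h, without any data. *)
Lemma final_boundary_integral :
  \int[vol]_(x in Omega) boundary_pairing (x, T) =
  \sum_i dot (Uc i N) (Y i N phi).
Proof.
have zT : T \in `[0, T] by rewrite in_itv/= lexx andbT ltW.
have [N0 _ tmN _] := htime.
have NN : (1 <= N <= N)%N by rewrite N0 leqnn.
rewrite (Rintegral_cells (h := fun i x => dot (Uc i N) (phi (x, T)))) //.
- apply: eq_bigr => i _.
  by rewrite (Rintegral_dotr _ (mcell i) (level_phi i zT)) /level_trace tmN.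
- by move=> i; exact: (integrable_dotr _ (mcell i) (level_phi i zT)).
move=> i x ix; rewrite /outflow /inflow /nu/= eqxx.
rewrite Pplus_final Pminus_final mul1mx mul0mx dot0l addr0 nflux_time scale1r.
rewrite (cellwise_cell Uc hspace htime NN ix)// tmN lexx andbT.
by have [_ + _] := tm_step htime NN; rewrite tmN.
Qed.

(** Away from the intersections of faces, the upwind flux of U_h with data g is
    the numerical flux, which uses the average of g, plus the projection of the
    deviation of g from its average. *)
Lemma lateral_boundary_integral Fr :
  \int[starea]_(p in lateral Omega T) boundary_pairing p =
  \sum_(e | is_bface G e) \sum_(1 <= m < N.+1)
     (dot (face_flux area G Fr g Uc (lcell G e) e m) (Z e m phi)
      + \int[starea]_(p in face G e `*` Defs.Im G m)
          dot (Pminus (onormal G (lcell G e) e, 0) (Uc (lcell G e) m)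
             *m (g p - gavg area G g e m)) (phi p)).
Proof.
have [M HM] := test_bounded tphi.
pose n e : ST := (onormal G (lcell G e) e, 0).
pose u e m := Uc (lcell G e) m.
pose F e m := face_flux area G Fr g Uc (lcell G e) e m.
pose D e m p := Pminus (n e) (u e m) *m (g p - gavg area G g e m).
have phis e m : is_bface G e -> (1 <= m <= N)%N ->
    vintegrable starea (face_slab e m) phi.
  move=> be mN c; apply: (face_trace_integrable T0 tphi hspace c (i := lcell G e)).
  - by rewrite /is_face eqxx.
  - exact: measurable_itv.
  - have [t0 _ tT] := tm_step htime mN; move=> t; rewrite /= !in_itv/= => /andP[h1 h2].
    by rewrite (le_trans t0 (ltW h1)) (le_trans (ltW h2) tT).
have iF e m : is_bface G e -> (1 <= m <= N)%N ->
    starea.-integrable (face_slab e m) (fun p => (dot (F e m) (phi p))%:E).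
  by move=> be mN; exact: (integrable_dotr _ (face_slab_measurable e m) (phis e m be mN)).
have iD e m : is_bface G e -> (1 <= m <= N)%N ->
    starea.-integrable (face_slab e m) (fun p => (dot (D e m p) (phi p))%:E).
  move=> be mN; have mS := face_slab_measurable e m.
  have sfin : (starea (face_slab e m) < +oo)%E.
    apply: le_lt_trans (_ : (starea (face G e `*` Defs.Im G m) < +oo)%E).
      apply: le_measure; rewrite ?inE//; first exact: (stface_measurable hspace).
      by move=> [x t] [/= ex tt]; split => //=; exact: subset_itv_oo_cc tt.
    by rewrite (stface_measure hspace htime)// ltry.
  have ib : vintegrable starea (face_slab e m) (D e m).
    apply: vintegrable_mulmx => //; apply: vintegrableB => //.
      move=> c; have [igl _ _] := ig c.
      exact: (integrableS lateral_measurable mS (face_slab_sub be mN) igl).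
    exact: vintegrable_cst.
  apply: (integrable_dot_bounded (M := M) mS ib) => [c|p c lp].
    by have /measurable_int/measurable_EFinP := phis e m be mN c.
  apply: HM; have [lO tt] := face_slab_sub be mN lp.
  rewrite closure_OmegaT//; split; first by case: lO.
  exact: subset_itv_oo_cc tt.
rewrite (Rintegral_lateral (h := fun e m p =>
  dot (F e m) (phi p) + dot (D e m p) (phi p))).
- apply: eq_bigr => e be; apply: eq_big_nat => m; rewrite ltnS => mN.
  have mS := face_slab_measurable e m.
  rewrite (RintegralD mS (iF e m be mN) (iD e m be mN)).
  rewrite /face_slab -!Rintegral_open_time; congr (_ + _).
  apply: Rintegral_dotr; first exact: (stface_measurable hspace).
  have [+ _ _] := test_trace_integrable oOmega T0 hspace htime tphi (lcell G e) mN.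
  by apply; rewrite /is_face eqxx.
- move=> e m be mN; have mS := face_slab_measurable e m.
  exact: (integrable_RD mS (iF e m be mN) (iD e m be mN)).
move=> e m x t be mN ex ue /andP[t1 t2].
have [t0 _ tT] := tm_step htime mN.
have nuE : nu G T (x, t) = n e.
  rewrite /nu/= lt_eqF; last exact: lt_le_trans tT.
  rewrite gt_eqF; last exact: le_lt_trans t1.
  by rewrite (bnormal_bface be ex ue) /n /onormal eqxx.
have UhE : Uh (x, t) = u e m.
  rewrite /cellwise/= (cell_of_bface hspace be ex ue).
  by rewrite (level_ofE htime mN)// t1 ltW.
rewrite /outflow /inflow nuE UhE -!dotDl; congr dot.
rewrite /D /F /face_flux be -/(n e) -/(u e m) mulmxBr -addrA; congr (_ + _).
by rewrite [RHS]addrC subrK.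
Qed.

Lemma boundary_integral_discrete Fr :
  (forall i, Uc i 0%N = initial_avg vol G g i) ->
  GI boundary_pairing =
  \sum_(e | is_bface G e) \sum_(1 <= m < N.+1)
     dot (face_flux area G Fr g Uc (lcell G e) e m) (Z e m phi)
  + \sum_i (dot (Uc i N) (Y i N phi) - dot (Uc i 0%N) (Y i 0%N phi))
  + data_oscillation vol area G g Uc phi.
Proof.
move=> U0; rewrite /GI (lateral_boundary_integral Fr) initial_boundary_integral.
rewrite final_boundary_integral /data_oscillation.
rewrite (eq_bigr _ (fun e _ => big_split _ _ _ _ _)) big_split/= !sumrB.
have -> : \sum_i dot (Uc i 0%N) (Y i 0%N phi) =
    \sum_i dot (initial_avg vol G g i) (Y i 0%N phi).
  by apply: eq_bigr => i _; rewrite U0.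
by ring.
Qed.

End discrete_boundary.

End boundary_identity.

(** * The error representation *)

Theorem corollary4p1 (R : realType) (d : nat) (hd : (0 < d)%N)
  (vol area : {sigma_finite_measure set 'rV[R]_d -> \bar R})
  (Omega : set 'rV[R]_d) (T : R)
  (I E : finType) (G : grid R d I E)
  (theta : R) (Fr : (I -> nat -> state R d) -> I -> E -> nat -> state R d)
  (g psi psiG phi : spacetime R d -> state R d)
  (U Ut : spacetime R d -> state R d) (Uc : I -> nat -> state R d)
  (* measures, domain, grid *)
  (hvol : is_lebesgue vol) (harea : is_face_area area G)
  (hOmega : open Omega) (hT : 0 < T)
  (hspace : is_space_grid vol area G Omega) (htime : is_time_grid G T)
  (* numerical flux *)
  (htheta : 0 <= theta <= 1) (hFr : riemann_flux G Fr)
  (* the weak solution U with trace Ut, and the discrete solution U_h *)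
  (hU : weak_solution vol area G Omega T g U Ut)
  (hUc : fv_solution vol area G Fr theta g Uc) :
  let Uh := cellwise G Uc in
  (* the solution of the approximate adjoint problem *)
  test_space vol Omega T phi ->
  adjoint_solution vol area G Omega T Uh psi psiG phi ->
  (* the integrals that appear are well defined *)
  GammaT_vintegrable vol area Omega T g ->
  GammaT_vintegrable vol area Omega T (outflow G T Uh) ->
  GammaT_vintegrable vol area Omega T (inflow G T Uh g) ->
  GammaT_integrable vol area Omega T
    (fun p => dot (outflow G T Ut p) (psiG p)) ->
  GammaT_integrable vol area Omega T
    (fun p => dot (outflow G T Uh p) (psiG p)) ->
  (forall c, measurable_fun (OmegaT Omega T) (fun p => psi p c 0)) ->
  (vol \x @lebesgue_measure R)%E.-integrable (OmegaT Omega T)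
    (fun p => (dot (U p) (psi p))%:E) ->
  (vol \x @lebesgue_measure R)%E.-integrable (OmegaT Omega T)
    (fun p => (dot (Uh p) (psi p))%:E) ->
  let eps_J := J vol area G Omega T psi psiG U Ut
               - J vol area G Omega T psi psiG Uh Uh in
  let eps_Gm := - GammaT_pair vol area Omega T
    (fun p => (Pminus (nu G T p) (Ut p) - Pminus (nu G T p) (Uh p)) *m g p)
    phi in
  let eps_Gp := - GammaT_pair vol area Omega T
    (fun p => outflow G T Ut p - outflow G T Uh p)
    (fun p => phi p - psiG p) in
  let eps_O := \int[(vol \x @lebesgue_measure R)%E]_(p in OmegaT Omega T)
    (\sum_(k < d) dot (eflux k (U p) - eflux k (Uh p)
                       - Atilde (Uh p) k *m (U p - Uh p)) (d_x k phi p)) in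
  (* the error representation; without the identification of g with the
     averages used by the scheme, the data oscillation remains *)
  (data_resolved vol area G g Uc ->
     eps_J + eps_Gm + eps_Gp + eps_O
     = eta_k vol area G Fr theta g Uc phi
       + eta_h vol area G Fr theta g Uc phi) /\
  eps_J + eps_Gm + eps_Gp + eps_O
  = eta_k vol area G Fr theta g Uc phi + eta_h vol area G Fr theta g Uc phi
    + data_oscillation vol area G g Uc phi.
Proof.
(* Linear bookkeeping: x1, x2, e, v and s are volume terms, p and q stand for
   outflow and inflow paired with phi, pu and qu for outflow paired with psi_Gamma. *)
have collect (x1 x2 e v s pu qu p1 p2 q1 q2 f D : R) :
    x1 - x2 + e = v - s -> v - p1 = q1 -> p2 + q2 = f + D ->
    x1 - pu - (x2 - qu) + - (q1 - q2) + - (p1 - p2 - (pu - qu)) + e = f - s + D.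
  by lra.
move=> Uh tphi [adj _] ig ioH iiH iopU iopH _ iUp iHp eps_J eps_Gm eps_Gp eps_O.
have [bvU _ [ifU ioU iiU _] weak] := hU.
have iU : vintegrable (vol \x @lebesgue_measure R)%E (OmegaT Omega T) U.
  by move=> c; case: (bvU c).
set GI := boundary_integral vol area Omega T.
pose oU p := outflow G T Ut p; pose oH p := outflow G T Uh p.
pose iUg p := inflow G T Ut g p; pose iHg p := inflow G T Uh g p.
have dotphi a := GammaT_dot_integrable hOmega hT hspace tphi (a := a).
pose Gint := GammaT_integrable vol area Omega T.
have GIB h k : Gint h -> Gint k -> GI (fun p => h p - k p) = GI h - GI k.
  exact: boundary_integralB.
have GIe h k : h =1 k -> GI h = GI k by exact: eq_boundary_integral.
have EGm : eps_Gm = - (GI (fun p => dot (iUg p) (phi p))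
                       - GI (fun p => dot (iHg p) (phi p))).
  rewrite -(GIB _ _ (dotphi _ iiU) (dotphi _ iiH)); congr (- _).
  by apply: GIe => p; rewrite mulmxBl dotBl.
have EGp : eps_Gp = - (GI (fun p => dot (oU p) (phi p))
                       - GI (fun p => dot (oH p) (phi p))
                       - (GI (fun p => dot (oU p) (psiG p))
                          - GI (fun p => dot (oH p) (psiG p)))).
  rewrite -(GIB _ _ (dotphi _ ioU) (dotphi _ ioH)) -(GIB _ _ iopU iopH).
  rewrite -GIB; first 1 last.
  - exact: (GammaT_integrableB hOmega (dotphi _ ioU) (dotphi _ ioH)).
  - exact: (GammaT_integrableB hOmega iopU iopH).
  congr (- _); apply: GIe => p.
  by rewrite dotBr !dotBl.
have W : OmegaT_pair vol Omega T U (d_t phi)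
    + \int[(vol \x @lebesgue_measure R)%E]_(p in OmegaT Omega T)
        (\sum_(k < d) dot (eflux k (U p)) (d_x k phi p))
    - GI (fun p => dot (oU p) (phi p)) = GI (fun p => dot (iUg p) (phi p)).
  exact: weak.
have V := volume_terms hOmega hT hspace htime tphi iU ifU adj iUp iHp.
have B := boundary_integral_discrete hOmega hT hspace htime tphi ig Fr
  (initial_value hUc).
rewrite (boundary_integralD hOmega (dotphi _ ioH) (dotphi _ iiH)) in B.
have N := eta_sum hOmega hT hspace htime hUc tphi.
rewrite (flux_sum hOmega hT hspace htime hFr hUc tphi) in N.
have main : eps_J + eps_Gm + eps_Gp + eps_O
  = eta_k vol area G Fr theta g Uc phi + eta_h vol area G Fr theta g Uc phi
    + data_oscillation vol area G g Uc phi.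
  rewrite EGm EGp N; exact: (collect _ _ _ _ _ (GI (fun p => dot (oU p) (psiG p)))
    (GI (fun p => dot (oH p) (psiG p))) _ _ _ _ _ _ V W B).
split=> // -[dl di]; rewrite main [X in _ + X](_ : _ = 0) ?addr0//.
rewrite /data_oscillation big1 ?add0r ?big1// => [i _|e be].
  apply: Rintegral_eq0_ae; apply: ae_imp (di i) => x dx ix.
  by rewrite -(dx ix) subrr dot0l.
rewrite big_nat big1// => m; rewrite ltnS => mN.
apply: Rintegral_eq0_ae; apply: ae_imp (dl e m be mN) => p dp ep.
by rewrite dp// dot0l.
Qed.
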